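(* Let $q\in\mathbb{C}^{*}$ with $0<|q|<1$ and let $a,b\in\mathbb{C}^{*}$ be such that $a/b$ is not an integer power of $q$. For any $x\in\mathbb{C}^{*}\setminus[1;q]$ we have $$\frac{(abx;q)_\infty}{\theta(-qx)}\,{}_2\varphi_1\left(\frac{q}{a},\frac{q}{b};0;q,abx\right)=\frac{\left(\frac{q}{a};q\right)_\infty}{\left(\frac{b}{a},q;q\right)_\infty}\frac{\theta(-aqx)}{\theta(-qx)}\,{}_2\varphi_1\left(a,0;\frac{aq}{b};q,\frac{q}{abx}\right)+\frac{\left(\frac{q}{b};q\right)_\infty}{\left(\frac{a}{b},q;q\right)_\infty}\frac{\theta(-bqx)}{\theta(-qx)}\,{}_2\varphi_1\left(b,0;\frac{bq}{a};q,\frac{q}{abx}\right).$$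
   Context: Notation: $(a;q)_0=1$, $(a;q)_n=(1-a)(1-aq)\cdots(1-aq^{n-1})$ for $n\ge1$, $(a;q)_\infty=\lim_{n\to\infty}(a;q)_n$, and $(a_1,\dots,a_m;q)_\infty=(a_1;q)_\infty\cdots(a_m;q)_\infty$. $\theta(x)=\theta_q(x)=\sum_{n\in\mathbb{Z}}q^{n(n-1)/2}x^n=(q,-x,-q/x;q)_\infty$ for $x\in\mathbb{C}^{*}$. For $\lambda\in\mathbb{C}^{*}$, the $q$-spiral is $[\lambda;q]=\lambda q^{\mathbb{Z}}=\{\lambda q^k : k\in\mathbb{Z}\}$. ${}_2\varphi_1(A,B;C;q,y)=\sum_{n\ge0}\frac{(A;q)_n(B;q)_n}{(C;q)_n(q;q)_n}y^n$ for $|y|<1$ (with $C\notin\{q^{-k}:k\ge0\}$), and ${}_2\varphi_1$ also denotes its meromorphic continuation to $y\in\mathbb{C}$, whose only possible poles are at $y=q^{-k}$, $k\ge0$. The identity is understood as an identity of meromorphic functions of $x$, i.e. after analytic continuation; both sides are holomorphic on $\mathbb{C}^{*}\setminus[1;q]$ after removing removable singularities. *)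

(* Defs.v *)
From mathcomp Require Import all_boot all_order all_algebra.
From mathcomp Require Import all_classical all_reals all_analysis.
From mathcomp Require Export complex.
Import Order.TTheory GRing.Theory Num.Theory.
Import numFieldNormedType.Exports.

Set Implicit Arguments.
Unset Strict Implicit.
Unset Printing Implicit Defensive.

Local Open Scope classical_set_scope.
Local Open Scope ring_scope.

Definition qpoch (K : numFieldType) (q a : K) (n : nat) : K :=
  \prod_(i < n) (1 - a * q ^+ i).

Definition qpoch_inf (K : numFieldType) (q a : K) : K := limn (qpoch q a).

(* The sum over all integers, split into n >= 0 and n = - m.+1, for which
   n (n - 1) / 2 = 'C(m.+2, 2). *)
Definition theta (K : numFieldType) (q x : K) : K :=
  limn (series (fun n : nat => q ^+ 'C(n, 2) * x ^+ n)) +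
  limn (series (fun m : nat => q ^+ 'C(m.+2, 2) * x ^- m.+1)).

Definition qspiral (K : numFieldType) (q l : K) : set K :=
  [set x | exists k : int, x = l * q ^ k].

(* Holomorphy is taken in the sense of Weierstrass, i.e. local expandability in
   a convergent power series; [meromorphic_at] allows a finite principal part
   and does not constrain the value of [f] at [z0] itself. *)
Definition holomorphic_at (K : numFieldType) (f : K -> K) (z0 : K) : Prop :=
  exists c : nat -> K,
    \forall z \near z0, series (fun n => c n * (z - z0) ^+ n) @ \oo --> f z.

Definition meromorphic_at (K : numFieldType) (f : K -> K) (z0 : K) : Prop :=
  exists (m : nat) (c : nat -> K),
    \forall z \near z0^',
      series (fun n => c n * (z - z0) ^+ n) @ \oo --> (z - z0) ^+ m * f z.

Definition phi21_series (K : numFieldType) (q A B C y : K) : K :=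
  limn (series (fun n : nat =>
    qpoch q A n * qpoch q B n / (qpoch q C n * qpoch q q n) * y ^+ n)).

Definition phi21_poles (K : numFieldType) (q : K) : set K :=
  [set y | exists k : nat, y = q ^- k].

Definition phi21_continuation (K : numFieldType) (q A B C : K) (F : K -> K) :
    Prop :=
  [/\ forall y, `|y| < 1 -> F y = phi21_series q A B C y,
      forall y, meromorphic_at F y
    & forall y, ~ phi21_poles q y -> holomorphic_at F y].

(* The continuation is selected by choice.  Off [phi21_poles q] its values do
   not depend on the choice; at points of [phi21_poles q] they are
   unspecified. *)
Definition phi21 (K : numFieldType) (q A B C : K) : K -> K :=
  xget (fun=> 0) [set F | phi21_continuation q A B C F].

(* Main.v *)
Require Import Defs.
From mathcomp Require Import all_boot all_order all_algebra.
From mathcomp Require Import all_classical all_reals all_analysis.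
From mathcomp Require Import ring lra zify.
Import Order.TTheory GRing.Theory Num.Theory.
Import numFieldNormedType.Exports.
Set Implicit Arguments.
Unset Strict Implicit.
Unset Printing Implicit Defensive.
Local Open Scope classical_set_scope.
Local Open Scope ring_scope.

(** Put [A = q / a], [B = q / b] and [z = a * b * x]. The function
    G(z) = (z;q)_oo 2phi1(A,B;0;q,z) is entire, and its n-th Taylor coefficient
    is (-1)^n q^(n(n-1)/2) h_n, where h_n is the coefficient of t^n in
    (ABt;q)_oo / ((At;q)_oo (Bt;q)_oo). Partial fractions at the poles
    t = 1/(A q^j) and t = 1/(B q^j) of this quotient give
    h_n = sum_j R_j (A q^j)^n + sum_j S_j (B q^j)^n, and the right-hand side
    vanishes for n < 0. Summing over all integers n therefore yields
    G(z) = sum_j R_j theta(-z A q^j) + sum_j S_j theta(-z B q^j).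
    By the quasi-periodicity theta(x) = x theta(q x) each inner theta is an
    explicit multiple of theta(-zA) or theta(-zB), and the multiples add up to
    the two series 2phi1 in the variable q/z: this is the connection formula for
    |q/z| < 1 ([connection_disc]).

    The partial fractions are obtained without the generating function. The
    moments U_n = sum_j R_j (A q^j)^n + sum_j S_j (B q^j)^n, for n any integer,
    satisfy the same second-order recurrence as h_n ([residue_sum_qdiff],
    [phi_numSS]), so that U_0 = 1 and U_(-1) = 0 suffice. Both are limits of
    Lagrange interpolation identities at the 2N nodes A q^i, B q^i, i < N
    ([interpolation], [residue_finite_cvg]).

    Outside the disc of convergence 2phi1 is the entire function
    (z;q)_oo 2phi1(z) divided by (z;q)_oo ([phi_fun_continuation]), and the
    identity theorem shows that every other continuation has the same values off
    the poles ([phi21_eq]). The formula for all z follows from the one for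
    |q/z| < 1 because both sides satisfy one q-difference equation, which
    determines the value at q^2 z from those at z and q z ([connection]).

    The common value H(x) = G(abx) / theta(-qx) is holomorphic because theta(-x)
    vanishes on the spiral of 1 only. This is the case B = 1 of the formula
    itself: there it degenerates to the triple product, which exhibits theta(-z)
    as a factor of (z;q)_oo ([theta_neq0]). *)

(** * Moduli *)

(** The norm of a [numFieldType] takes its values in the field itself, which need
    not be totally ordered; [modulus] is its real form, so that estimates are
    made in [R]. Completeness enters only as the convergence of absolutely
    convergent series. Two fields are of interest: the complex numbers, and [R]
    itself, over which the moduli of the terms of a theta series are summed. *)
Record real_modulus (R : realType) (K : numFieldType) := RealModulus {
  modulus :> K -> R;
  embed : {rmorphism R -> K};
  embed_le : forall r s, (embed r <= embed s) = (r <= s);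
  embed_modulus : forall x, embed (modulus x) = `|x|;
  absolutely_summable_cvg : forall (u : nat -> K) (B : R),
    (forall N, \sum_(i < N) modulus (u i) <= B) -> cvgn (series u)
}.

Section Modulus.
Variables (R : realType) (K : numFieldType) (m : real_modulus R K).
Implicit Types (x y z l : K) (u v : nat -> K) (r s e : R).

Let embed_inj : injective (embed m) := fmorph_inj _.

Lemma embed_lt r s : (embed m r < embed m s) = (r < s).
Proof. by rewrite !lt_neqAle embed_le (inj_eq embed_inj). Qed.

Lemma modulus_ge0 x : 0 <= m x.
Proof. by rewrite -(embed_le m) embed_modulus rmorph0. Qed.

Lemma modulus_eq0 x : (m x == 0) = (x == 0).
Proof. by rewrite -(inj_eq embed_inj) embed_modulus rmorph0 normr_eq0. Qed.

Lemma modulus_gt0 x : (0 < m x) = (x != 0).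
Proof. by rewrite lt_neqAle modulus_ge0 andbT eq_sym modulus_eq0. Qed.

Lemma modulus0 : m 0 = 0. Proof. by apply/eqP; rewrite modulus_eq0. Qed.

Lemma modulus1 : m 1 = 1.
Proof. by apply: embed_inj; rewrite embed_modulus normr1 rmorph1. Qed.

Lemma modulusM x y : m (x * y) = m x * m y.
Proof. by apply: embed_inj; rewrite rmorphM !embed_modulus normrM. Qed.

Lemma modulusN x : m (- x) = m x.
Proof. by apply: embed_inj; rewrite !embed_modulus normrN. Qed.

Lemma modulusV x : m x^-1 = (m x)^-1.
Proof. by apply: embed_inj; rewrite fmorphV !embed_modulus normfV. Qed.

Lemma modulusX x n : m (x ^+ n) = m x ^+ n.
Proof. by apply: embed_inj; rewrite rmorphXn !embed_modulus normrX. Qed.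

Lemma modulusBC x y : m (x - y) = m (y - x).
Proof. by rewrite -opprB modulusN. Qed.

Lemma modulusD x y : m (x + y) <= m x + m y.
Proof. by rewrite -(embed_le m) rmorphD !embed_modulus ler_normD. Qed.

Lemma modulusB x y : m (x - y) <= m x + m y.
Proof. by rewrite -[m y]modulusN modulusD. Qed.

Lemma modulus_embed r : 0 <= r -> m (embed m r) = r.
Proof.
move=> r0; apply: embed_inj; rewrite embed_modulus ger0_norm //.
by rewrite -(rmorph0 (embed m)) embed_le.
Qed.

Lemma modulus_sum (I : Type) (s : seq I) (P : pred I) (F : I -> K) :
  m (\sum_(i <- s | P i) F i) <= \sum_(i <- s | P i) m (F i).
Proof.
elim/big_ind2: _ => [|x r y s' hx hy|//]; first by rewrite modulus0.
by rewrite (le_trans (modulusD _ _)) // lerD.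
Qed.

Lemma modulus_cvgP u l :
  u @ \oo --> l <->
  forall e, 0 < e -> exists N, forall n, (N <= n)%N -> m (u n - l) < e.
Proof.
split.
  move/cvgrPdist_lt => h e e0.
  have /h [N _ hN] : 0 < embed m e by rewrite -(rmorph0 (embed m)) embed_lt.
  exists N => n Nn; have := hN n Nn.
  by rewrite /= -(embed_modulus m) embed_lt modulusBC.
move=> h; apply/cvgrPdist_lt => e e0.
have [|N hN] := h (m e); first by rewrite modulus_gt0 gt_eqF.
exists N => // n Nn /=; rewrite -[e](gtr0_norm e0) -!(embed_modulus m) embed_lt.
by rewrite modulusBC hN.
Qed.

Lemma modulus_nearP z (P : set K) :
  (\forall w \near z, P w) <->
  exists2 r, 0 < r & forall w, m (w - z) < r -> P w.
Proof.
split.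
  move/nbhs_normP => [e /= e0 h].
  exists (m e) => [|w mw]; first by rewrite modulus_gt0 gt_eqF.
  apply: h; rewrite /= -[e](gtr0_norm e0) -!(embed_modulus m) embed_lt.
  by rewrite modulusBC.
move=> [r r0 h]; apply/nbhs_normP; exists (embed m r) => /=.
  by rewrite -(rmorph0 (embed m)) embed_lt.
by move=> w /=; rewrite -(embed_modulus m) embed_lt modulusBC; apply: h.
Qed.

Lemma modulus_dnearP z (P : set K) :
  (\forall w \near z^', P w) <->
  exists2 r, 0 < r & forall w, w != z -> m (w - z) < r -> P w.
Proof.
rewrite near_withinE; apply: iff_trans (modulus_nearP _ _) _.
by split=> -[r r0 h]; exists r => // w; [move=> wz mw|move=> mw wz]; apply: h.
Qed.

Lemma cvg_eventually u v l N : (forall n, (N <= n)%N -> u n = v n) ->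
  v @ \oo --> l -> u @ \oo --> l.
Proof.
by move=> uv vl; apply: cvg_trans vl; apply: near_eq_cvg; exists N => // n /uv.
Qed.

Lemma modulus_le_lim u l B : u @ \oo --> l -> (forall n, m (u n) <= B) -> m l <= B.
Proof.
move/modulus_cvgP => h hB; rewrite leNgt; apply/negP => Bl.
have [|N hN] := h (m l - B); first by rewrite subr_gt0.
have := hN N (leqnn _); have := modulusD (u N) (l - u N).
rewrite subrKC modulusBC; have := hB N; lra.
Qed.

Lemma cvg_bounded u l : u @ \oo --> l -> exists2 B, 0 < B & forall n, m (u n) <= B.
Proof.
move/modulus_cvgP => /(_ 1 ltr01) [N hN].
have p n : 0 <= \sum_(i < n) m (u i) by apply: sumr_ge0 => i _; apply: modulus_ge0.
have l0 := modulus_ge0 l.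
exists (m l + 1 + \sum_(i < N) m (u i)) => [|n]; first by have := p N; lra.
have [/hN|nN] := leqP N n.
  by have := modulusD (u n - l) l; rewrite subrK; have := p N; lra.
rewrite (bigD1 (Ordinal nN)) //=.
have : 0 <= \sum_(i < N | i != Ordinal nN) m (u i).
  by apply: sumr_ge0 => i _; apply: modulus_ge0.
lra.
Qed.

(** * Absolutely convergent series *)

(** Absolute convergence is recorded together with a bound on the sum, since it is
    the bounds that are propagated through products and compositions. *)
Definition sum_bounded (b : nat -> R) B := forall N, \sum_(i < N) b i <= B.

Definition tsum u := limn (series u).

Lemma tsum_cvg u B : sum_bounded (m \o u) B -> series u @ \oo --> tsum u.
Proof. exact: absolutely_summable_cvg. Qed.

Lemma tsum_eq u l : series u @ \oo --> l -> tsum u = l.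
Proof. exact: cvg_lim. Qed.

Lemma seriesE u n : series u n = \sum_(i < n) u i.
Proof. by rewrite /series /= big_mkord. Qed.

Lemma modulus_tsum u B : sum_bounded (m \o u) B -> m (tsum u) <= B.
Proof.
move=> h; apply: modulus_le_lim (tsum_cvg h) _ => n.
by rewrite seriesE (le_trans (modulus_sum _ _ _)).
Qed.

Lemma tsum_split u B J : sum_bounded (m \o u) B ->
  tsum u = \sum_(i < J) u i + tsum (fun i => u (J + i)%N).
Proof.
move=> h; apply: tsum_eq; rewrite -(cvg_shiftn J).
have hJ : sum_bounded (m \o (fun i => u (J + i)%N)) B.
  move=> N; apply: le_trans (h (J + N)%N).
  by rewrite big_split_ord /= lerDr sumr_ge0 // => i _; apply: modulus_ge0.
have -> : (fun n => series u (n + J)%N) =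
    (fun n => \sum_(i < J) u i + series (fun i => u (J + i)%N) n).
  by apply/funext => n; rewrite !seriesE addnC big_split_ord.
by apply: cvgD; [apply: cvg_cst|apply: tsum_cvg hJ].
Qed.

Lemma sum_bounded_tail (b : nat -> R) B e : (forall n, 0 <= b n) ->
  sum_bounded b B -> 0 < e -> exists J, sum_bounded (fun i => b (J + i)%N) e.
Proof.
move=> b0 hB e0.
have ub : ubound (range (fun N => \sum_(i < N) b i)) B by move=> _ [N _ <-].
have hs : has_sup (range (fun N => \sum_(i < N) b i)).
  by split; [exists (\sum_(i < 0) b i), 0%N|exists B].
have [_ [J _ <-] hJ] := sup_adherent e0 hs.
exists J => N.
have : \sum_(i < J + N) b i <= sup (range (fun N => \sum_(i < N) b i)).
  by apply: ub_le_sup; [exists B|exists (J + N)%N].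
by rewrite big_split_ord /=; lra.
Qed.

Lemma sum_bounded_le (h : nat -> K) (c : nat -> R) B :
  (forall j, m (h j) <= c j) -> sum_bounded c B -> sum_bounded (m \o h) B.
Proof.
by move=> hc cC N; apply: le_trans (cC N); apply: ler_sum => i _; apply: hc.
Qed.

(** Dominated convergence for series: the tails are small uniformly in [N],
    and the heads converge as finite sums. *)
Lemma tannery (f : nat -> nat -> K) (g : nat -> K) (b : nat -> R) B :
  (forall N j, m (f N j) <= b j) -> sum_bounded b B ->
  (forall j, f ^~ j @ \oo --> g j) ->
  (fun N => tsum (f N)) @ \oo --> tsum g.
Proof.
move=> fb bB fg.
have b0 j : 0 <= b j by apply: le_trans (fb 0%N j); apply: modulus_ge0.
have gb j : m (g j) <= b j by apply: modulus_le_lim (fg j) _ => N; apply: fb.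
apply/modulus_cvgP => e e0.
have [|J hJ] := @sum_bounded_tail b B (e / 4) b0 bB; first by lra.
have : (fun N => \sum_(i < J) f N i) @ \oo --> \sum_(i < J) g i.
  elim: (J) => [|k IH].
    under eq_fun do rewrite big_ord0; rewrite big_ord0; exact: cvg_cst.
  under eq_fun do rewrite big_ord_recr; rewrite big_ord_recr /=.
  exact: cvgD IH (fg k).
move/modulus_cvgP => /(_ (e / 4)) []; first by lra.
move=> N0 hN; exists N0 => N /hN h.
rewrite (tsum_split J (sum_bounded_le (fb N) bB)) (tsum_split J (sum_bounded_le gb bB)).
have h1 : m (tsum (fun i => f N (J + i)%N)) <= e / 4.
  by apply: modulus_tsum; apply: sum_bounded_le hJ => j; apply: fb.
have h2 : m (tsum (fun i => g (J + i)%N)) <= e / 4.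
  by apply: modulus_tsum; apply: sum_bounded_le hJ => j; apply: gb.
rewrite opprD addrACA.
have := modulusD (\sum_(i < J) f N i - \sum_(i < J) g i)
  (tsum (fun i => f N (J + i)%N) - tsum (fun i => g (J + i)%N)).
have := modulusB (tsum (fun i => f N (J + i)%N)) (tsum (fun i => g (J + i)%N)).
lra.
Qed.

Lemma tsumZ (a : K) u B : sum_bounded (m \o u) B ->
  tsum (fun n => a * u n) = a * tsum u.
Proof.
move=> h; apply: tsum_eq.
have -> : series (fun n => a * u n) = (fun n => a * series u n).
  by apply/funext => n; rewrite !seriesE mulr_sumr.
by apply: cvgM; [apply: cvg_cst|apply: tsum_cvg h].
Qed.

Lemma tsumD u v B C : sum_bounded (m \o u) B -> sum_bounded (m \o v) C ->
  tsum (fun n => u n + v n) = tsum u + tsum v.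
Proof.
move=> h k; apply: tsum_eq.
have -> : series (fun n => u n + v n) = (fun n => series u n + series v n).
  by apply/funext => n; rewrite !seriesE big_split.
by apply: cvgD; [apply: tsum_cvg h|apply: tsum_cvg k].
Qed.

(** Interchange of summations, as dominated convergence of the partial sums in
    the second index. *)
Lemma tsum_exchange (f : nat -> nat -> K) (b : nat -> R) B :
  (forall j, sum_bounded (m \o f j) (b j)) -> sum_bounded b B ->
  series (fun n => tsum (f ^~ n)) @ \oo --> tsum (fun j => tsum (f j)).
Proof.
move=> fb bB.
have b0 j : 0 <= b j by have := fb j 0%N; rewrite big_ord0.
have sb j n : m (f j n) <= b j.
  apply: le_trans (fb j n.+1); rewrite big_ord_recr /= lerDr.
  by apply: sumr_ge0 => i _; apply: modulus_ge0.
have -> : series (fun n => tsum (f ^~ n)) =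
   (fun N => tsum (fun j => \sum_(n < N) f j n)).
  apply/funext => N; rewrite seriesE.
  elim: N => [|N IH].
    under [in RHS]eq_fun do rewrite big_ord0.
    rewrite big_ord0; apply/esym/tsum_eq.
    have -> : series (fun _ => 0) = (fun _ => 0 : K).
      by apply/funext => n; rewrite seriesE big1.
    exact: cvg_cst.
  under [in RHS]eq_fun do rewrite big_ord_recr /=.
  rewrite big_ord_recr /= IH; apply/esym; apply: tsumD.
    apply: sum_bounded_le bB => j; apply: le_trans (fb j N).
    exact: modulus_sum.
  by apply: sum_bounded_le bB => j; apply: sb.
apply: (@tannery _ _ b B) => [N j||j]; last 1 first.
- have := tsum_cvg (fb j).
  suff -> : series (f j) = (fun N => \sum_(n < N) f j n) by [].
  by apply/funext => N; rewrite seriesE.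
- by apply: le_trans (modulus_sum _ _ _) _; apply: fb.
- exact: bB.
Qed.

Lemma sum_bounded_geometric r : 0 <= r -> r < 1 ->
  sum_bounded (fun n => r ^+ n) (1 - r)^-1.
Proof.
move=> r0 r1 N; have r1' : 0 < 1 - r by lra.
rewrite -[leRHS]mul1r ler_pdivlMr // -opprB mulrN mulrC -subrX1 opprB.
by have := exprn_ge0 N r0; lra.
Qed.

End Modulus.

(** * Cauchy products *)

Section PowerSeries.
Variables (R : realType) (K : numFieldType) (m : real_modulus R K).
Implicit Types (w x y z l : K) (u v c d : nat -> K) (r s e M : R).

Lemma tsum_finite u N : (forall i, (N <= i)%N -> u i = 0) ->
  tsum u = \sum_(i < N) u i.
Proof.
move=> u0; apply: tsum_eq; apply: (cvg_eventually (v := fun _ => \sum_(i < N) u i) (N := N)).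
  move=> n /subnKC <-; rewrite seriesE big_split_ord /= [X in _ + X]big1 ?addr0 //.
  by move=> i _; apply: u0; apply: leq_addr.
exact: cvg_cst.
Qed.

Definition conv (S : pzRingType) (a b : nat -> S) n := \sum_(i < n.+1) a i * b (n - i)%N.

Lemma sum_conv (S : pzRingType) (a b : nat -> S) N :
  \sum_(n < N) conv a b n = \sum_(i < N) a i * \sum_(j < N - i) b j.
Proof.
elim: N => [|N IH]; first by rewrite !big_ord0.
rewrite big_ord_recr /= IH /conv [in RHS]big_ord_recr /= subSnn big_ord1.
rewrite [in LHS]big_ord_recr /= subnn addrA -big_split /=; congr (_ + _).
apply: eq_bigr => i _; rewrite subSn; last exact: ltnW.
by rewrite big_ord_recr /= mulrDr.
Qed.

Lemma modulus_conv u v n : m (conv u v n) <= conv (m \o u) (m \o v) n.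
Proof.
by apply: le_trans (modulus_sum _ _ _ _) _; apply: ler_sum => i _; rewrite modulusM.
Qed.

Lemma sum_bounded_conv u v B C : sum_bounded (m \o u) B -> sum_bounded (m \o v) C ->
  sum_bounded (m \o conv u v) (B * C).
Proof.
move=> hB hC N.
have B0 : 0 <= B by have := hB 0%N; rewrite big_ord0.
have C0 : 0 <= C by have := hC 0%N; rewrite big_ord0.
apply: (@le_trans _ _ (\sum_(n < N) conv (m \o u) (m \o v) n)).
  by apply: ler_sum => n _; apply: modulus_conv.
rewrite sum_conv (@le_trans _ _ (\sum_(i < N) m (u i) * C)) //.
  by apply: ler_sum => i _; rewrite ler_wpM2l ?modulus_ge0.
by rewrite -mulr_suml ler_wpM2r.
Qed.

(** Dominated convergence: the N-th partial sum of the convolution is a series in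
    [i] whose inner sum is cut at [N - i], hence empty for [N <= i]. *)
Lemma tsum_conv u v B C : sum_bounded (m \o u) B -> sum_bounded (m \o v) C ->
  tsum (conv u v) = tsum u * tsum v.
Proof.
move=> hB hC; apply: tsum_eq.
have -> : series (conv u v) =
    (fun N => tsum (fun i => u i * \sum_(j < N - i) v j)).
  apply/funext => N; rewrite seriesE sum_conv; apply/esym/tsum_finite => i Ni.
  by rewrite (_ : N - i = 0)%N ?big_ord0 ?mulr0 //; apply/eqP; rewrite subn_eq0.
have -> : tsum u * tsum v = tsum (fun i => u i * tsum v).
  rewrite mulrC -(tsumZ _ hB); congr tsum; apply/funext => i; exact: mulrC.
apply: (@tannery _ _ m _ _ (fun i => m (u i) * C) (B * C)) => [N j|N|j].
- rewrite modulusM ler_wpM2l ?modulus_ge0 //.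
  exact: le_trans (modulus_sum _ _ _ _) (hC _).
- rewrite -mulr_suml ler_wpM2r ?hB //.
  by have := hC 0%N; rewrite big_ord0.
- apply: cvgM; first exact: cvg_cst.
  rewrite -(cvg_shiftn j) /=.
  under eq_fun do rewrite addnK -seriesE.
  exact: tsum_cvg hC.
Qed.

Lemma tsum_geometric x : m x < 1 -> tsum (fun n => x ^+ n) = (1 - x)^-1.
Proof.
move=> x1; have hs : sum_bounded (m \o (fun n => x ^+ n)) (1 - m x)^-1.
  apply: (@sum_bounded_le _ _ _ _ (fun n => m x ^+ n)) => [j|].
    by rewrite modulusX.
  by apply: sum_bounded_geometric => //; apply: modulus_ge0.
have x1' : 1 - x != 0.
  apply/eqP => h; have := x1.
  by rewrite (_ : x = 1) ?modulus1 ?ltxx //; apply/eqP; rewrite eq_sym -subr_eq0 h.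
apply: (mulfI x1'); rewrite mulfV // mulrBl mul1r {1}(tsum_split 1 hs).
rewrite big_ord1 expr0 -(tsumZ _ hs) (_ : (fun i => x ^+ (1 + i)) = (fun n => x * x ^+ n)).
  by rewrite addrK.
by apply/funext => n; rewrite add1n exprS.
Qed.

(** * Power series with a majorant *)

Definition pseries c w := tsum (fun n => c n * w ^+ n).

(** [M] bounds the norm of [c] in the Banach algebra of the power series that
    converge absolutely on the closed disc of radius [r]. This norm being
    submultiplicative, products and composites are controlled by it. *)
Definition majorized c r M := sum_bounded (fun n => m (c n) * r ^+ n) M.

Lemma majorized_ge0 c r M : majorized c r M -> 0 <= M.
Proof. by move/(_ 0%N); rewrite big_ord0. Qed.

Lemma pseries_bounded c r M w : majorized c r M -> m w <= r ->
  sum_bounded (m \o (fun n => c n * w ^+ n)) M.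
Proof.
move=> h wr; apply: sum_bounded_le h => j.
rewrite modulusM modulusX ler_wpM2l ?modulus_ge0 //.
by rewrite lerXn2r // nnegrE ?(le_trans _ wr) ?modulus_ge0.
Qed.

Lemma modulus_pseries c r M w : majorized c r M -> m w <= r ->
  m (pseries c w) <= M.
Proof. by move=> h wr; apply: modulus_tsum (pseries_bounded h wr). Qed.

Lemma majorized_le c r s M : 0 <= s -> s <= r -> majorized c r M -> majorized c s M.
Proof.
move=> s0 sr h N; apply: le_trans (h N); apply: ler_sum => i _.
rewrite ler_wpM2l ?modulus_ge0 // lerXn2r // nnegrE //; exact: le_trans sr.
Qed.

Lemma majorized_geometric c r s B : 0 <= s -> s < r ->
  (forall n, m (c n) * r ^+ n <= B) -> majorized c s (B * (1 - s / r)^-1).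
Proof.
move=> s0 sr h N; have r0 : 0 < r by lra.
have B0 : 0 <= B.
  by apply: le_trans (h 0%N); rewrite expr0 mulr1 modulus_ge0.
have q0 : 0 <= s / r by rewrite divr_ge0 // ltW.
have q1 : s / r < 1 by rewrite ltr_pdivrMr // mul1r.
apply: le_trans (ler_wpM2l B0 (sum_bounded_geometric q0 q1 N)).
rewrite mulr_sumr; apply: ler_sum => i _.
rewrite expr_div_n mulrA ler_pdivlMr ?exprn_gt0 // mulrAC.
by rewrite ler_wpM2r ?exprn_ge0.
Qed.

Lemma pseries0 c : pseries c 0 = c 0%N.
Proof.
rewrite /pseries (@tsum_finite _ 1) => [|[|i] // _].
  by rewrite big_ord1 expr0 mulr1.
by rewrite expr0n mulr0.
Qed.

Lemma majorized_shift c r M n : 0 < r -> majorized c r M ->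
  majorized (fun i => c (n + i)%N) r (M / r ^+ n).
Proof.
move=> r0 h N; rewrite ler_pdivlMr ?exprn_gt0 // mulr_suml.
apply: le_trans (h (n + N)%N); rewrite big_split_ord /=.
rewrite (eq_bigr (fun i : 'I_N => m (c (n + i)%N) * r ^+ (n + i))).
  rewrite lerDr sumr_ge0 // => i _.
  by rewrite mulr_ge0 ?modulus_ge0 // exprn_ge0 // ltW.
by move=> i _; rewrite -mulrA -exprD addnC.
Qed.

Lemma pseries_shift c r M w n : 0 < r -> majorized c r M -> m w <= r ->
  pseries c w = \sum_(i < n) c i * w ^+ i + w ^+ n * pseries (fun i => c (n + i)%N) w.
Proof.
move=> r0 h wr; rewrite /pseries (tsum_split n (pseries_bounded h wr)); congr (_ + _).
rewrite -(tsumZ _ (pseries_bounded (majorized_shift n r0 h) wr)); congr tsum.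
by apply/funext => i; rewrite exprD mulrCA.
Qed.

Lemma pseries_lipschitz0 c r M w : 0 < r -> majorized c r M -> m w <= r ->
  m (pseries c w - c 0%N) <= M / r * m w.
Proof.
move=> r0 h wr; rewrite (pseries_shift 1 r0 h wr) big_ord1 expr0 mulr1 addrAC subrr add0r.
rewrite modulusM expr1 mulrC ler_wpM2r ?modulus_ge0 //.
by have := modulus_pseries (majorized_shift 1 r0 h) wr; rewrite expr1.
Qed.

(** The coefficients of a power series are determined by its values at points
    accumulating at the centre. *)
Lemma pseries_coef0 c r M : 0 < r -> majorized c r M ->
  (forall e, 0 < e -> exists w, [/\ w != 0, m w < e & pseries c w = 0]) ->
  forall n, c n = 0.
Proof.
move=> r0 h hz; elim/ltn_ind => n IH.
apply/eqP; rewrite -(modulus_eq0 m) eq_le modulus_ge0 andbT.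
apply/ler_addgt0Pr => e e0; rewrite add0r.
have hn := majorized_shift n r0 h; set M' := M / _ in hn.
have M0 : 0 <= M' by apply: majorized_ge0 hn.
have d0 : 0 < Num.min r (e / (M' / r + 1)).
  by rewrite lt_min r0 divr_gt0 // ltr_wpDl // divr_ge0 // ltW.
have [w [w0 +]] := hz _ d0; rewrite lt_min => /andP[wr we].
rewrite (pseries_shift n r0 h (ltW wr)) big1 => [|i _]; last first.
  by rewrite IH // mul0r.
move/eqP; rewrite add0r mulf_eq0 expf_eq0 (negPf w0) andbF /= => /eqP p0.
have := pseries_lipschitz0 r0 hn (ltW wr).
rewrite p0 sub0r modulusN addn0 => /le_trans; apply.
move: we; rewrite ltr_pdivlMr; last by rewrite ltr_wpDl // divr_ge0 // ltW.
by have := modulus_ge0 m w; rewrite mulrC mulrDl; lra.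
Qed.

Lemma majorizedD c d r M M' : 0 <= r -> majorized c r M -> majorized d r M' ->
  majorized (fun n => c n + d n) r (M + M').
Proof.
move=> r0 h h' N; apply: le_trans (lerD (h N) (h' N)).
rewrite -big_split; apply: ler_sum => i _ /=.
by rewrite -mulrDl ler_wpM2r ?exprn_ge0 // modulusD.
Qed.

Lemma pseriesD c d r M M' w : majorized c r M -> majorized d r M' -> m w <= r ->
  pseries (fun n => c n + d n) w = pseries c w + pseries d w.
Proof.
move=> h h' wr; rewrite /pseries -(tsumD (pseries_bounded h wr) (pseries_bounded h' wr)).
by congr tsum; apply/funext => n; rewrite mulrDl.
Qed.

Lemma majorizedZ (a : K) c r M : majorized c r M ->
  majorized (fun n => a * c n) r (m a * M).
Proof.
move=> h N; apply: le_trans (ler_wpM2l (modulus_ge0 m a) (h N)).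
by rewrite mulr_sumr; apply: ler_sum => i _; rewrite modulusM mulrA.
Qed.

Lemma pseriesZ (a : K) c r M w : majorized c r M -> m w <= r ->
  pseries (fun n => a * c n) w = a * pseries c w.
Proof.
move=> h wr; rewrite /pseries -(tsumZ _ (pseries_bounded h wr)).
by congr tsum; apply/funext => n; rewrite mulrA.
Qed.

Lemma pseries_inj c d r M M' : 0 < r -> majorized c r M -> majorized d r M' ->
  (forall w, m w < r -> pseries c w = pseries d w) -> forall n, c n = d n.
Proof.
move=> r0 h h' cd n; apply/eqP; rewrite -subr_eq0; apply/eqP.
have hd := majorizedZ (-1) h'.
rewrite -[- d n]mulN1r; move: n.
apply: (pseries_coef0 r0 (majorizedD (ltW r0) h hd)) => e e0.
pose t := Num.min r e / 2; have mt : 0 < Num.min r e by rewrite lt_min r0.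
have t0 : 0 < t by rewrite divr_gt0.
have mw : m (embed m t) = t by rewrite modulus_embed // ltW.
have [tr te] : t < r /\ t < e.
  by apply/andP; rewrite -lt_min ltr_pdivrMr //; lra.
exists (embed m t); split; first by rewrite -(modulus_gt0 m) mw.
  by rewrite mw.
rewrite (pseriesD h hd) ?mw ?(ltW tr) //.
by rewrite (pseriesZ _ h') ?cd ?mulN1r ?subrr // mw ?(ltW tr).
Qed.

(** * Products and composition of power series *)

Lemma conv_pow c d w n :
  conv c d n * w ^+ n = conv (fun i => c i * w ^+ i) (fun i => d i * w ^+ i) n.
Proof.
rewrite mulr_suml; apply: eq_bigr => i _.
by rewrite mulrACA -exprD subnKC // -ltnS.
Qed.

Lemma majorized_pseries_bounded c r M : 0 <= r ->
  majorized c r M <-> sum_bounded (m \o (fun n => c n * embed m r ^+ n)) M.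
Proof.
move=> r0; rewrite /majorized.
suff -> : (m \o (fun n => c n * embed m r ^+ n)) = (fun n => m (c n) * r ^+ n) by [].
by apply/funext => n /=; rewrite modulusM modulusX modulus_embed.
Qed.

Lemma majorized_conv c d r M M' : 0 <= r -> majorized c r M -> majorized d r M' ->
  majorized (conv c d) r (M * M').
Proof.
move=> r0; rewrite !majorized_pseries_bounded // => h h'.
rewrite (funext (conv_pow c d (embed m r))); exact: sum_bounded_conv.
Qed.

Lemma pseries_conv c d r M M' w : majorized c r M -> majorized d r M' -> m w <= r ->
  pseries (conv c d) w = pseries c w * pseries d w.
Proof.
move=> h h' wr; rewrite /pseries (funext (conv_pow c d w)).
exact: tsum_conv (pseries_bounded h wr) (pseries_bounded h' wr).
Qed.

Definition conv_exp c j : nat -> K := iter j (conv c) (fun n => (n == 0%N)%:R).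

Lemma majorized_one r : majorized (fun n => (n == 0%N)%:R) r 1.
Proof.
case=> [|N]; first by rewrite big_ord0.
by rewrite big_ord_recl /= modulus1 mul1r expr0 big1 ?addr0 // => i _; rewrite modulus0 mul0r.
Qed.

Lemma pseries_one w : pseries (fun n => (n == 0%N)%:R) w = 1.
Proof.
rewrite /pseries (@tsum_finite _ 1) ?big_ord1 ?expr0 ?mulr1 //.
by case=> // i _; rewrite mul0r.
Qed.

Lemma majorized_conv_exp c r M j : 0 <= r -> majorized c r M ->
  majorized (conv_exp c j) r (M ^+ j).
Proof.
move=> r0 h; elim: j => [|j IH]; first exact: majorized_one.
by rewrite exprS; apply: majorized_conv.
Qed.

Lemma pseries_conv_exp c r M w j : majorized c r M -> m w <= r ->
  pseries (conv_exp c j) w = pseries c w ^+ j.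
Proof.
move=> h wr; have r0 := le_trans (modulus_ge0 m w) wr.
elim: j => [|j IH]; first by rewrite pseries_one.
by rewrite exprS -IH; apply: pseries_conv (majorized_conv_exp j r0 h) wr.
Qed.

Definition conv_comp c d n := tsum (fun j => c j * conv_exp d j n).

Lemma coef_conv_exp d r s j n : 0 <= r -> majorized d r s ->
  m (conv_exp d j n) * r ^+ n <= s ^+ j.
Proof.
move=> r0 h; apply: le_trans (majorized_conv_exp j r0 h n.+1).
rewrite big_ord_recr /= lerDr sumr_ge0 // => i _.
by rewrite mulr_ge0 ?modulus_ge0 ?exprn_ge0.
Qed.

Lemma conv_comp_bounded c d r s M n : 0 < r -> majorized c s M -> majorized d r s ->
  sum_bounded (m \o (fun j => c j * conv_exp d j n)) (M / r ^+ n).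
Proof.
move=> r0 h h' N; rewrite ler_pdivlMr ?exprn_gt0 // mulr_suml.
apply: le_trans (h N); apply: ler_sum => j _ /=.
by rewrite modulusM -mulrA ler_wpM2l ?modulus_ge0 // coef_conv_exp // ltW.
Qed.

(** The coefficient of index [n] is bounded by [M / r ^+ n] only, so the radius has
    to shrink; half of it gives a geometric series of sum 2. *)
Lemma majorized_conv_comp c d r s M : 0 < r -> majorized c s M -> majorized d r s ->
  majorized (conv_comp c d) (r / 2) (M * 2).
Proof.
move=> r0 h h'.
have := @majorized_geometric (conv_comp c d) r (r / 2) M.
rewrite (_ : (1 - r / 2 / r)^-1 = 2); last by field; rewrite gt_eqF.
apply; [lra|lra|move=> n].
by rewrite -ler_pdivlMr ?exprn_gt0 //; apply: modulus_tsum (conv_comp_bounded _ r0 h h').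
Qed.

Lemma pseries_conv_comp c d r s M w : 0 < r -> majorized c s M -> majorized d r s ->
  m w <= r -> pseries (conv_comp c d) w = pseries c (pseries d w).
Proof.
move=> r0 h h' wr; apply: tsum_eq.
have s0 := majorized_ge0 h'.
have E1 : (fun n => conv_comp c d n * w ^+ n) =
    (fun n => tsum (fun j => c j * (conv_exp d j n * w ^+ n))).
  apply/funext => n; rewrite mulrC -(tsumZ _ (conv_comp_bounded n r0 h h')).
  by congr tsum; apply/funext => j; ring.
have E2 : pseries c (pseries d w) =
    tsum (fun j => tsum (fun n => c j * (conv_exp d j n * w ^+ n))).
  congr tsum; apply/funext => j; rewrite -(pseries_conv_exp j h' wr).
  by rewrite (tsumZ _ (pseries_bounded (majorized_conv_exp j (ltW r0) h') wr)).
rewrite E1 E2.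
apply: (@tsum_exchange _ _ m (fun j n => c j * (conv_exp d j n * w ^+ n))
  (fun j => m (c j) * s ^+ j) M) => // j N.
have := pseries_bounded (majorized_conv_exp j (ltW r0) h') wr N.
move/(ler_wpM2l (modulus_ge0 m (c j))); apply: le_trans.
by rewrite mulr_sumr; apply: ler_sum => i _ /=; rewrite modulusM.
Qed.

(** * Holomorphic functions *)

(** Convergence at one point bounds the terms there, which makes the series
    geometrically dominated at any smaller radius. *)
Lemma majorized_of_cvg c w : w != 0 -> cvgn (series (fun n => c n * w ^+ n)) ->
  exists M, majorized c (m w / 2) M.
Proof.
move=> w0 /(cvg_bounded m) [B B0 hB]; have mw : 0 < m w by rewrite modulus_gt0.
exists ((B * 2) * (1 - m w / 2 / m w)^-1).
apply: majorized_geometric; [lra|lra|move=> n].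
rewrite -modulusX -modulusM.
have -> : c n * w ^+ n = series (fun n => c n * w ^+ n) n.+1
    - series (fun n => c n * w ^+ n) n.
  by rewrite !seriesE big_ord_recr /= addrAC subrr add0r.
apply: le_trans (modulusB _ _ _) _; have := hB n; have := hB n.+1; lra.
Qed.

Lemma meromorphicP (f : K -> K) z : meromorphic_at f z <->
  exists k c r M, [/\ 0 < r, majorized c r M &
    forall w, w != z -> m (w - z) < r -> (w - z) ^+ k * f w = pseries c (w - z)].
Proof.
split=> [[k [c /(modulus_dnearP m) [r r0 h]]]|[k [c [r [M [r0 h hf]]]]]].
  pose t := r / 2; have t0 : 0 < t by rewrite divr_gt0.
  have mt : m (embed m t) = t by rewrite modulus_embed // ltW.
  have tr : t < r by rewrite /t; lra.
  have t0' : embed m t != 0 by rewrite -(modulus_gt0 m) mt.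
  have := h (embed m t + z); rewrite -subr_eq0 addrK mt => /(_ t0' tr) ct.
  have [M hM] := majorized_of_cvg t0' (cvgP _ ct).
  rewrite mt in hM; exists k, c, (t / 2), M; split=> //; first by rewrite divr_gt0.
  by move=> w wz wt; apply/esym/tsum_eq/h => //; move: tr; lra.
exists k, c; apply/(modulus_dnearP m); exists r => // w wz wr.
rewrite hf //; apply: tsum_cvg (pseries_bounded h (ltW wr)).
Qed.

Lemma holomorphicP (f : K -> K) z : holomorphic_at f z <->
  exists c r M, [/\ 0 < r, majorized c r M &
    forall w, m (w - z) < r -> f w = pseries c (w - z)].
Proof.
split=> [[c /(modulus_nearP m) [r r0 h]]|[c [r [M [r0 h hf]]]]].
  pose t := r / 2; have t0 : 0 < t by rewrite divr_gt0.
  have mt : m (embed m t) = t by rewrite modulus_embed // ltW.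
  have tr : t < r by rewrite /t; lra.
  have t0' : embed m t != 0 by rewrite -(modulus_gt0 m) mt.
  have := h (embed m t + z); rewrite addrK mt => /(_ tr) ct.
  have [M hM] := majorized_of_cvg t0' (cvgP _ ct).
  rewrite mt in hM; exists c, (t / 2), M; split=> //; first by rewrite divr_gt0.
  by move=> w wt; apply/esym/tsum_eq/h; move: tr; lra.
exists c; apply/(modulus_nearP m); exists r => // w wr.
rewrite hf //; apply: tsum_cvg (pseries_bounded h (ltW wr)).
Qed.

Lemma holomorphic_eq f g z : f =1 g -> holomorphic_at f z -> holomorphic_at g z.
Proof. by move=> /funext ->. Qed.

Lemma holomorphic_lipschitz f z : holomorphic_at f z ->
  exists r C, [/\ 0 < r, 0 <= C & forall w, m (w - z) < r -> m (f w - f z) <= C * m (w - z)].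
Proof.
move/holomorphicP => [c [r [M [r0 h hf]]]]; exists r, (M / r); split=> //.
  by rewrite divr_ge0 ?(majorized_ge0 h) // ltW.
move=> w wr; rewrite !hf ?subrr ?modulus0 // pseries0.
exact: pseries_lipschitz0 (ltW wr).
Qed.

Lemma holomorphic_cst (a : K) z : holomorphic_at (fun=> a) z.
Proof.
apply/holomorphicP; exists (fun n => a * (n == 0%N)%:R), 1, (m a * 1); split=> //.
  exact: majorizedZ (majorized_one 1).
by move=> w wr; rewrite (pseriesZ _ (majorized_one 1) (ltW wr)) pseries_one mulr1.
Qed.

Lemma holomorphicD f g z : holomorphic_at f z -> holomorphic_at g z ->
  holomorphic_at (fun w => f w + g w) z.
Proof.
move=> /holomorphicP [c [r [M [r0 h hf]]]] /holomorphicP [d [s [M' [s0 h' hg]]]].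
have t0 : 0 < Num.min r s by rewrite lt_min r0.
have tr : Num.min r s <= r by rewrite ge_min lexx.
have ts : Num.min r s <= s by rewrite ge_min lexx orbT.
have {}h := majorized_le (ltW t0) tr h; have {}h' := majorized_le (ltW t0) ts h'.
apply/holomorphicP; exists (fun n => c n + d n), (Num.min r s), (M + M'); split=> //.
  exact: majorizedD (ltW t0) h h'.
move=> w wt; rewrite (pseriesD h h' (ltW wt)) hf ?hg //; exact: lt_le_trans wt _.
Qed.

Lemma holomorphicM f g z : holomorphic_at f z -> holomorphic_at g z ->
  holomorphic_at (fun w => f w * g w) z.
Proof.
move=> /holomorphicP [c [r [M [r0 h hf]]]] /holomorphicP [d [s [M' [s0 h' hg]]]].
have t0 : 0 < Num.min r s by rewrite lt_min r0.
have tr : Num.min r s <= r by rewrite ge_min lexx.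
have ts : Num.min r s <= s by rewrite ge_min lexx orbT.
have {}h := majorized_le (ltW t0) tr h; have {}h' := majorized_le (ltW t0) ts h'.
apply/holomorphicP; exists (conv c d), (Num.min r s), (M * M'); split=> //.
  exact: majorized_conv (ltW t0) h h'.
move=> w wt; rewrite (pseries_conv h h' (ltW wt)) hf ?hg //; exact: lt_le_trans wt _.
Qed.

(** The expansion at [z] is the composite with the polynomial [z + w], whose
    norm on the disc of radius [s - m z] is [s]. *)
Lemma holomorphic_pseries c s M z : majorized c s M -> m z < s ->
  holomorphic_at (pseries c) z.
Proof.
move=> h zs; pose r := s - m z; have r0 : 0 < r by rewrite subr_gt0.
pose d n := if n is i.+1 then (i == 0%N)%:R else z.
have pd w : pseries d w = w + z.
  rewrite /pseries (@tsum_finite _ 2) => [|[|[|i]] // _]; last by rewrite mul0r.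
  by rewrite big_ord_recl big_ord1 /= expr0 mulr1 mul1r expr1 addrC.
have hd : majorized d r s.
  case=> [|[|N]].
  - by rewrite big_ord0; have := modulus_ge0 m z; lra.
  - by rewrite big_ord1 /= expr0 mulr1 ltW.
  rewrite 2!big_ord_recl big1 => [|i _]; last by rewrite modulus0 mul0r.
  by rewrite /= expr0 modulus1 expr1 /r; lra.
apply/holomorphicP; exists (conv_comp c d), (r / 2), (M * 2); split.
- by rewrite divr_gt0.
- exact: majorized_conv_comp h hd.
- move=> w wr; rewrite (pseries_conv_comp r0 h hd) ?pd ?subrK //.
  lra.
Qed.

(** On a small enough disc [f - f z], having no constant term, has norm below the
    radius of convergence of [g] at [f z]. *)
Lemma holomorphic_comp f g z : holomorphic_at g (f z) -> holomorphic_at f z ->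
  holomorphic_at (fun w => g (f w)) z.
Proof.
move=> /holomorphicP [c [s [M' [s0 hc hg]]]] /holomorphicP [d [r [M [r0 hd hf]]]].
have fz : f z = d 0%N by rewrite hf ?subrr ?modulus0 // pseries0.
pose d0 n := if n is i.+1 then d i.+1 else 0.
have M0 := majorized_ge0 hd.
(* Removing the constant term makes the norm at radius [t] at most [t / r * M]. *)
pose t := Num.min r (r * (s / 2) / (M + 1)).
have t0 : 0 < t by rewrite lt_min r0 divr_gt0 ?mulr_gt0 ?divr_gt0 // ltr_wpDl.
have tr : t <= r by rewrite ge_min lexx.
have ts : t / r * M <= s / 2.
  rewrite mulrAC ler_pdivrMr // (@le_trans _ _ (r * (s / 2) / (M + 1) * M)) //.
    by rewrite ler_wpM2r // ge_min lexx orbT.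
  rewrite mulrAC ler_pdivrMr ?ltr_wpDl // [s / 2 * r]mulrC ler_wpM2l ?lerDl //.
  by rewrite mulr_ge0 // ltW ?divr_gt0.
have hd0 : majorized d0 t (s / 2).
  move=> N; apply: le_trans ts; case: N => [|N].
    by rewrite big_ord0 mulr_ge0 // divr_ge0 // ltW.
  rewrite big_ord_recl /= modulus0 mul0r add0r.
  have := hd N.+1; rewrite big_ord_recl /= => hN.
  apply: (@le_trans _ _ (t / r * \sum_(i < N) m (d i.+1) * r ^+ i.+1)).
    rewrite mulr_sumr; apply: ler_sum => i _.
    rewrite mulrCA ler_wpM2l ?modulus_ge0 // exprS -mulrA exprS -[r * _ in leRHS]mulrC.
    rewrite [r^-1 * _]mulrC mulfK ?gt_eqF // ler_wpM2l ?(ltW t0) //.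
    by rewrite lerXn2r // nnegrE ltW.
  apply: ler_wpM2l; first by rewrite divr_ge0 // ltW.
  by apply: le_trans hN; rewrite lerDr expr0 mulr1 modulus_ge0.
have fd w : m (w - z) < t -> f w - f z = pseries d0 (w - z).
  move=> wt; have wr : m (w - z) < r by apply: lt_le_trans tr.
  rewrite fz hf // (pseries_shift 1 r0 hd (ltW wr)) big_ord1 expr0 mulr1 addrAC subrr.
  rewrite (pseries_shift 1 t0 hd0 (ltW wt)) big_ord1 expr0 mulr1 /= !add0r.
  by congr (_ * _); congr pseries; apply/funext => n; rewrite add1n.
have hc' : majorized c (s / 2) M' by apply: majorized_le hc; lra.
apply/holomorphicP; exists (conv_comp c d0), (t / 2), (M' * 2); split.
- by rewrite divr_gt0.
- exact: majorized_conv_comp hc' hd0.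
- move=> w wt; have wt' : m (w - z) < t by lra.
  rewrite hg fd ?(pseries_conv_comp t0 hc' hd0 (ltW wt')) //.
  by have := modulus_pseries hd0 (ltW wt'); lra.
Qed.

Lemma holomorphic_affine (a b : K) z : holomorphic_at (fun w => a * w + b) z.
Proof.
pose d n := if n is i.+1 then a * (i == 0%N)%:R else a * z + b.
apply/holomorphicP; exists d, 1, (m (a * z + b) + m a); split=> //.
  case=> [|[|N]].
  - by rewrite big_ord0 addr_ge0 ?modulus_ge0.
  - by rewrite big_ord1 /= mulr1 lerDl modulus_ge0.
  rewrite 2!big_ord_recl big1 => [|i _]; last by rewrite /= mulr0 modulus0 mul0r.
  by rewrite /= !mulr1 addr0.
move=> w _; rewrite /pseries (@tsum_finite _ 2) => [|[|[|i]] // _]; last first.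
  by rewrite /= mulr0 mul0r.
by rewrite big_ord_recl big_ord1 /= mulr1; ring.
Qed.

Lemma holomorphic_inv z : z != 0 -> holomorphic_at (fun w => w^-1) z.
Proof.
move=> z0; have mz : 0 < m z by rewrite modulus_gt0.
apply/holomorphicP; exists (fun n => z^-1 * (- z^-1) ^+ n), (m z / 2), (m z^-1 * 2).
split; first by rewrite divr_gt0.
  apply: (@majorizedZ _ (fun n => (- z^-1) ^+ n)) => N.
  rewrite [leRHS](_ : 2 = (1 - 1 / 2)^-1); last by field.
  apply: le_trans (@sum_bounded_geometric _ (1 / 2) _ _ N); [|lra|lra].
  apply: ler_sum => i _; rewrite modulusX modulusN modulusV -exprMn.
  by rewrite mulrA mulVf ?gt_eqF.
move=> w wz; pose x := - z^-1 * (w - z).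
have x1 : m x < 1.
  rewrite modulusM modulusN modulusV mulrC ltr_pdivrMr // mul1r; lra.
rewrite /pseries.
have -> : (fun n => z^-1 * (- z^-1) ^+ n * (w - z) ^+ n) = (fun n => z^-1 * x ^+ n).
  by apply/funext => n; rewrite -mulrA -exprMn.
have hb : sum_bounded (m \o (fun n => x ^+ n)) (1 - m x)^-1.
  apply: (@sum_bounded_le _ _ _ _ (fun n => m x ^+ n)) => [j|].
    by rewrite modulusX.
  by apply: sum_bounded_geometric => //; apply: modulus_ge0.
rewrite (tsumZ _ hb) tsum_geometric // -invfM; congr (_^-1).
by rewrite /x; field.
Qed.

Lemma holomorphicV f z : f z != 0 -> holomorphic_at f z ->
  holomorphic_at (fun w => (f w)^-1) z.
Proof. by move=> fz hf; apply: holomorphic_comp (holomorphic_inv fz) hf. Qed.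

End PowerSeries.

(** * The identity theorem *)

Section Identity.
Variables (R : realType) (K : numFieldType) (m : real_modulus R K).
Implicit Types (w x y z l : K) (u v c d : nat -> K) (r s e M : R).

Lemma holomorphic_meromorphic (f g : K -> K) z k : holomorphic_at g z ->
  (forall w, w != z -> (w - z) ^+ k * f w = g w) -> meromorphic_at f z.
Proof.
move=> [c hc] fg; exists k, c; near=> w.
rewrite fg; last by near: w; exact: nbhs_dnbhs_neq.
by near: w; apply: nbhs_dnbhs.
Unshelve. all: by end_near. Qed.

Definition monomial k : nat -> K := fun n => (n == k)%:R.

Lemma majorized_monomial k r : 0 <= r -> majorized m (monomial k) r (r ^+ k).
Proof.
move=> r0 N; rewrite (eq_bigr (fun i : 'I_N => if i == k :> nat then r ^+ k else 0)).
  rewrite -big_mkcond /=; have [kN|Nk] := ltnP k N.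
    by rewrite (big_pred1 (Ordinal kN)).
  rewrite big_pred0 ?exprn_ge0 // => i; apply/eqP => ik.
  by have := ltn_ord i; rewrite ik ltnNge Nk.
move=> i _; rewrite /monomial; case: eqP => [->|_]; first by rewrite modulus1 mul1r.
by rewrite modulus0 mul0r.
Qed.

Lemma pseries_monomial k w : pseries (monomial k) w = w ^+ k.
Proof.
rewrite /pseries (@tsum_finite _ _ k.+1) => [|i ki].
  rewrite big_ord_recr /= big1 ?add0r => [|i _]; first by rewrite /monomial eqxx mul1r.
  by rewrite /monomial ltn_eqF ?mul0r.
by rewrite /monomial gtn_eqF ?mul0r.
Qed.

(** Clearing denominators turns the identity theorem for power series into one
    for meromorphic functions, valid at a common pole as well. *)
Lemma meromorphic_identity (f g : K -> K) z : meromorphic_at f z -> meromorphic_at g z ->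
  (forall e, 0 < e -> exists w, [/\ w != z, m (w - z) < e & f w = g w]) ->
  \forall w \near z^', f w = g w.
Proof.
move=> /(meromorphicP m) [k [c [r [M [r0 h hf]]]]].
move=> /(meromorphicP m) [l [d [s [M' [s0 h' hg]]]]] acc.
pose t := Num.min r s; have t0 : 0 < t by rewrite lt_min r0.
have tr : t <= r by rewrite ge_min lexx.
have ts : t <= s by rewrite ge_min lexx orbT.
have {}h := majorized_le (ltW t0) tr h; have {}h' := majorized_le (ltW t0) ts h'.
have hl := majorized_monomial l (ltW t0); have hk := majorized_monomial k (ltW t0).
have hc := majorized_conv (ltW t0) hl h.
have hd := majorizedZ (-1) (majorized_conv (ltW t0) hk h').
have E w : w != z -> m (w - z) < t ->
    pseries (fun n => conv (monomial l) c n + -1 * conv (monomial k) d n) (w - z) =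
    (w - z) ^+ (k + l) * (f w - g w).
  move=> wz wt; rewrite (pseriesD hc hd (ltW wt)).
  rewrite (pseriesZ _ (majorized_conv (ltW t0) hk h') (ltW wt)).
  rewrite (pseries_conv hl h (ltW wt)) (pseries_conv hk h' (ltW wt)).
  rewrite !pseries_monomial -hf -?hg //; [|exact: lt_le_trans wt _..].
  by rewrite exprD; ring.
have Z := pseries_coef0 t0 (majorizedD (ltW t0) hc hd).
apply/(modulus_dnearP m); exists t => // w wz wt.
have := E w wz wt.
rewrite /pseries (_ : (fun n => _) = fun=> 0).
  rewrite (@tsum_finite _ _ 0) ?big_ord0 // => /esym/eqP.
  by rewrite mulf_eq0 expf_eq0 !subr_eq0 (negPf wz) andbF /= => /eqP.
apply/funext => n; rewrite Z ?mul0r // => e e0.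
have [|x [xz + fg]] := acc (Num.min t e); first by rewrite lt_min t0.
rewrite lt_min => /andP[xt xe].
by exists (x - z); split; rewrite ?subr_eq0 // E // fg subrr mulr0.
Qed.

(** The points near which two meromorphic functions agree form an open and
    closed set; following them along a line through the origin leaves only the
    connectedness of the real line to invoke. *)
Lemma meromorphic_identity_global (f g : K -> K) :
  (forall z, meromorphic_at f z) -> (forall z, meromorphic_at g z) ->
  (\forall w \near 0^', f w = g w) -> forall z, \forall w \near z^', f w = g w.
Proof.
move=> hf hg h0 z; have [->//|z0] := eqVneq z 0.
have mz : 0 < m z by rewrite modulus_gt0.
pose A := [set t : R | \forall w \near (embed m t * z)^', f w = g w].
have mt s t : m (embed m s * z - embed m t * z) = `|s - t| * m z.
  rewrite -mulrBl modulusM -rmorphB /=; congr (_ * _).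
  case: (ger0P (s - t)) => h; first by rewrite modulus_embed.
  by rewrite -modulusN -rmorphN modulus_embed // oppr_ge0 ltW.
suff AT : A = [set: R].
  by have : [set: R] 1 by []; rewrite -AT /A /= rmorph1 mul1r.
have near_move (x y : K) r : 0 < r -> m (y - x) < r ->
    (forall w, w != x -> m (w - x) < r -> f w = g w) -> \forall w \near y^', f w = g w.
  move=> r0 yxr h; apply/(modulus_dnearP m); have [->|yx] := eqVneq y x.
    by exists r.
  have myx : 0 < m (y - x) by rewrite modulus_gt0 subr_eq0.
  exists (Num.min (r - m (y - x)) (m (y - x))); first by rewrite lt_min subr_gt0 yxr.
  move=> w wy; rewrite lt_min => /andP[w1 w2]; apply: h.
    by apply/eqP => wx; move: w2; rewrite wx modulusBC ltxx.
  have := modulusD m (w - y) (y - x); rewrite subrKA; lra.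
have oA : open A.
  rewrite openE => t /(modulus_dnearP m) [r r0 h]; apply/nbhs_normP.
  exists (r / m z) => /=; first by rewrite divr_gt0.
  move=> s /=; rewrite distrC ltr_pdivlMr // -mt => st.
  exact: near_move r0 st h.
have cA : closed A.
  move=> t clt; apply: meromorphic_identity => // e e0.
  have /clt : nbhs t (ball t (e / 2 / m z)).
    by apply: nbhsx_ballx; rewrite !divr_gt0.
  move=> [s [/(modulus_dnearP m) [r r0 h]]].
  rewrite /ball /= distrC ltr_pdivlMr // -mt => st.
  pose x := embed m s * z; pose y := embed m t * z.
  (* A point of agreement near [y]: any point close to [x] except [x] itself,
     where nothing is known, and [y]. *)
  have : exists w, [/\ w != x, w != y & m (w - x) < Num.min r (e / 2)].
    pose p := Num.min r (e / 2) / 2; have mp : 0 < Num.min r (e / 2).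
      by rewrite lt_min r0 divr_gt0.
    have p0 : 0 < p by rewrite divr_gt0.
    have mE k : 0 <= k -> m (embed m k) = k by exact: modulus_embed.
    have pz k : 0 < k -> x + embed m k != x.
      by move=> k0; rewrite -subr_eq0 addrC addKr -(modulus_gt0 m) mE // ltW.
    have pm k : 0 < k -> k <= p -> m (x + embed m k - x) < Num.min r (e / 2).
      by move=> k0 kp; rewrite addrC addKr mE ?(ltW k0) //; move: kp; rewrite /p; lra.
    have [E|/eqP N] := eqVneq (x + embed m p) y.
      exists (x + embed m (p / 2)); split; [apply: pz|rewrite -E|apply: pm]; try lra.
      rewrite (inj_eq (addrI _)) (inj_eq (fmorph_inj _)); apply/eqP; lra.
    by exists (x + embed m p); split; [apply: pz|apply/eqP|apply: pm].
  move=> [w [wx wy]]; rewrite lt_min => /andP[wr we]; exists w; split=> //; last exact: h.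
  have := modulusD m (w - x) (x - y); rewrite subrKA -/x -/y in st *; lra.
have cR : connected [set: R] by apply/connected_intervalP => x y _ _ ? _.
apply: cR; [exists 0|exists A|exists A] => //; rewrite ?setTI //.
by rewrite /A /= rmorph0 mul0r.
Qed.

Lemma holomorphic_eq_of_dnbhs (f g : K -> K) z : holomorphic_at f z -> holomorphic_at g z ->
  (\forall w \near z^', f w = g w) -> f z = g z.
Proof.
move=> /(holomorphic_lipschitz m) [r [C [r0 C0 hf]]].
move=> /(holomorphic_lipschitz m) [s [D [s0 D0 hg]]].
move=> /(modulus_dnearP m) [t t0 h].
apply/eqP; rewrite -subr_eq0 -(modulus_eq0 m) eq_le modulus_ge0 andbT.
apply/ler_addgt0Pr => e e0; rewrite add0r.
have CD : 0 < C + D + 1 by lra.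
pose p := Num.min (Num.min r s) (Num.min t (e / (C + D + 1))).
have p0 : 0 < p by rewrite !lt_min r0 s0 t0 divr_gt0.
pose w := z + embed m (p / 2).
have mw : m (w - z) = p / 2 by rewrite /w addrC addKr modulus_embed // divr_ge0 // ltW.
have wz : w != z by rewrite -subr_eq0 -(modulus_gt0 m) mw divr_gt0.
have : m (w - z) < p by rewrite mw; lra.
rewrite !lt_min => /andP[/andP[wr ws] /andP[wt we]].
have := hf w wr; have := hg w ws; rewrite (h w wz wt).
have := modulusB m (g w - g z) (g w - f z); rewrite opprB addrC subrKA => h1 h2 h3.
move: we; rewrite ltr_pdivlMr // => we.
have := modulus_ge0 m (w - z); nra.
Qed.

(** The continuation selected by choice may be replaced, off the poles, by any
    explicit one. *)
Lemma phi21_eq (q A B C : K) (F : K -> K) y :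
  phi21_continuation q A B C F -> ~ phi21_poles q y -> phi21 q A B C y = F y.
Proof.
move=> hF ny; have [F1 F2 F3] := hF.
have [G1 G2 G3] : phi21_continuation q A B C (phi21 q A B C) by apply: xgetPex; exists F.
apply: holomorphic_eq_of_dnbhs; [exact: G3|exact: F3|].
apply: meromorphic_identity_global => //.
apply/(modulus_dnearP m); exists 1 => // w _; rewrite subr0 => w1.
have {}w1 : `|w| < 1 by rewrite -(embed_modulus m) -(rmorph1 (embed m)) embed_lt.
by rewrite G1 // F1.
Qed.

End Identity.

(** * Entire series and q-difference equations *)

Section Entire.
Variables (R : realType) (K : numFieldType) (m : real_modulus R K).
Implicit Types (a v w x y z l : K) (u c d : nat -> K) (r s e M : R).

Definition converges_at c r := exists M, majorized m c r M.

Definition entire c := forall r, 0 <= r -> converges_at c r.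

Definition shift1 c n := if n is i.+1 then c i else 0.

Lemma pseries_scale c x z : pseries c (x * z) = pseries (fun n => x ^+ n * c n) z.
Proof. by congr tsum; apply/funext => n; rewrite exprMn; ring. Qed.

Lemma converges_at_scale c x r : m x <= 1 -> 0 <= r -> converges_at c r ->
  converges_at (fun n => x ^+ n * c n) r.
Proof.
move=> x1 r0 [M h]; exists M => N; apply: le_trans (h N); apply: ler_sum => i _.
rewrite modulusM modulusX ler_wpM2r ?exprn_ge0 // -[leRHS]mul1r.
by rewrite ler_wpM2r ?modulus_ge0 // exprn_ile1 ?modulus_ge0.
Qed.

(** Absolute convergence on the closed disc of radius [m z] is carried along with
    the value, so that q-difference equations of sums can be read off from their
    coefficients. *)
Definition sums_to c z v := converges_at c (m z) /\ pseries c z = v.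

Lemma sums_to_pseries c z : converges_at c (m z) -> sums_to c z (pseries c z).
Proof. by []. Qed.

Lemma sums_to_scale c x z : m x <= 1 -> converges_at c (m z) ->
  sums_to (fun n => x ^+ n * c n) z (pseries c (x * z)).
Proof.
by move=> x1 h; split; [exact: converges_at_scale (modulus_ge0 m z) h|rewrite pseries_scale].
Qed.

Lemma sums_to_shift c z v : sums_to c z v -> sums_to (shift1 c) z (z * v).
Proof.
move=> [[M h] <-]; have z0 := modulus_ge0 m z.
have h' : majorized m (shift1 c) (m z) (m z * M).
  case=> [|N]; first by rewrite big_ord0 mulr_ge0 // (majorized_ge0 h).
  rewrite big_ord_recl /= modulus0 mul0r add0r.
  apply: le_trans (ler_wpM2l z0 (h N)); rewrite mulr_sumr.
  by apply: ler_sum => i _; rewrite exprS mulrCA.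
split; first by exists (m z * M).
rewrite /pseries (tsum_split 1 (pseries_bounded h' (lexx _))) big_ord1 mul0r add0r.
rewrite -(tsumZ _ (pseries_bounded h (lexx _))); congr tsum.
by apply/funext => n; rewrite add1n /= exprS mulrCA.
Qed.

Lemma sums_toD c d z v w : sums_to c z v -> sums_to d z w ->
  sums_to (fun n => c n + d n) z (v + w).
Proof.
move=> [[M h] <-] [[M' h'] <-]; split; last exact: pseriesD h h' (lexx _).
by exists (M + M'); apply: majorizedD h h'; apply: modulus_ge0.
Qed.

Lemma sums_toZ a c z v : sums_to c z v -> sums_to (fun n => a * c n) z (a * v).
Proof.
move=> [[M h] <-]; split; last exact: pseriesZ h (lexx _).
by exists (m a * M); apply: majorizedZ.
Qed.

Lemma exp_small x e : m x < 1 -> 0 < e -> exists N, forall n, (N <= n)%N -> m x ^+ n < e.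
Proof.
move=> x1 e0; have e0' : 0 < e / 2 by rewrite divr_gt0.
have p n : 0 <= m x ^+ n by rewrite exprn_ge0 ?modulus_ge0.
have [J hJ] := sum_bounded_tail p (sum_bounded_geometric (modulus_ge0 m x) x1) e0'.
exists J => n /subnKC <-; set k := (n - J)%N.
have : m x ^+ (J + k) <= e / 2.
  apply: le_trans (hJ k.+1); rewrite big_ord_recr /= lerDr.
  by apply: sumr_ge0.
lra.
Qed.

Lemma cvg_exp0 x : m x < 1 -> (fun n => x ^+ n) @ \oo --> (0 : K).
Proof.
move=> x1; apply/(modulus_cvgP m) => e /(exp_small x1) [N hN].
by exists N => n /hN; rewrite subr0 modulusX.
Qed.

Lemma pseries_cvg0 c r u : 0 < r -> converges_at c r -> u @ \oo --> (0 : K) ->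
  (fun n => pseries c (u n)) @ \oo --> c 0%N.
Proof.
move=> r0 [M h] /(modulus_cvgP m) u0; apply/(modulus_cvgP m) => e e0.
have M0 := majorized_ge0 h.
have M1 : 0 < M / r + 1 by rewrite ltr_wpDl // divr_ge0 // ltW.
have [|N hN] := u0 (Num.min r (e / (M / r + 1))); first by rewrite lt_min r0 divr_gt0.
exists N => n /hN; rewrite subr0 lt_min => /andP[ur ue].
apply: le_lt_trans (pseries_lipschitz0 r0 h (ltW ur)) _.
move: ue; rewrite ltr_pdivlMr //; have := modulus_ge0 m (u n); nra.
Qed.

(** A recurrence whose coefficients decay geometrically forces eventual decay
    at the rate (3/4) ^ n after any rescaling, because 1/4 * (3/4 + 1) < (3/4) ^ 2. *)
Lemma entire_of_recurrence c x (L : R) : m x < 1 -> 0 <= L ->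
  (forall k, m (c k.+2) <= L * m x ^+ k * (m (c k.+1) + m (c k))) -> entire c.
Proof.
move=> x1 L0 hc r r0; pose t := r + 1.
have t1 : 1 <= t by rewrite /t; lra.
suff [M h] : converges_at c t by exists M; apply: majorized_le h; rewrite /t //; lra.
have t0 : 0 < t by lra.
have Lt : 0 < L * t ^+ 2 + 1 by rewrite ltr_wpDl // mulr_ge0 // exprn_ge0 // ltW.
have [|N hN] := @exp_small x (1 / 4 / (L * t ^+ 2 + 1)) x1; first by rewrite !divr_gt0.
pose b k := m (c k) * t ^+ k.
have b0 k : 0 <= b k by rewrite mulr_ge0 ?modulus_ge0 // exprn_ge0 // ltW.
have bS k : (N <= k)%N -> b k.+2 <= 1 / 4 * (b k.+1 + b k).
  move=> /hN; rewrite ltr_pdivlMr // => xk.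
  have xk0 : 0 <= m x ^+ k by rewrite exprn_ge0 ?modulus_ge0.
  have Lx : L * m x ^+ k * t ^+ 2 <= 1 / 4.
    by move: xk; rewrite mulrDr mulr1; nra.
  apply: (@le_trans _ _ (L * m x ^+ k * t ^+ 2 * (b k.+1 + b k))); last first.
    by rewrite ler_wpM2r // addr_ge0.
  have tk : 0 <= t ^+ k by rewrite exprn_ge0 // ltW.
  have h1 : b k.+2 <= L * m x ^+ k * (m (c k.+1) + m (c k)) * t ^+ k.+2.
    by rewrite ler_wpM2r ?exprn_ge0 // ltW.
  apply: le_trans h1 _; rewrite (_ : L * _ * _ * _ =
    L * m x ^+ k * t ^+ 2 * (m (c k.+1) * t ^+ k + m (c k) * t ^+ k)); last first.
    by rewrite !exprS; ring.
  apply: ler_wpM2l; first by rewrite !mulr_ge0 // ?exprn_ge0 // ltW.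
  by rewrite /b lerD2r ler_wpM2l ?modulus_ge0 // exprS -[leLHS]mul1r ler_wpM2r.
pose P := b N + 4 / 3 * b N.+1.
have bP j : b (N + j)%N <= P * (3 / 4) ^+ j /\ b (N + j.+1)%N <= P * (3 / 4) ^+ j.+1.
  elim: j => [|j [IH1 IH2]].
    rewrite addn0 addn1 expr0 expr1 /P; have := b0 N; have := b0 N.+1; lra.
  split=> //; rewrite !addnS in IH2 *; apply: le_trans (bS _ (leq_addr _ _)) _.
  rewrite !exprS; move: IH2; rewrite exprS.
  have : 0 <= P * (3 / 4) ^+ j by exact: le_trans (b0 _) IH1.
  lra.
have P0 : 0 <= P by rewrite /P addr_ge0 // mulr_ge0.
exists (\sum_(i < N) b i + P * (1 - 3 / 4)^-1) => n.
have S0 k : 0 <= \sum_(i < k) b i by apply: sumr_ge0.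
have tail k : \sum_(i < k) b (N + i)%N <= P * (1 - 3 / 4)^-1.
  apply: (@le_trans _ _ (P * \sum_(i < k) (3 / 4) ^+ i)).
    by rewrite mulr_sumr; apply: ler_sum => i _; have [] := bP i.
  by rewrite ler_wpM2l //; apply: sum_bounded_geometric; lra.
apply: (@le_trans _ _ (\sum_(i < N + n) b i)).
  by rewrite addnC big_split_ord /= lerDl sumr_ge0 // => i _; apply: b0.
by rewrite big_split_ord lerD2l; apply: tail.
Qed.

Lemma holomorphic_entire c z : entire c -> holomorphic_at (pseries c) z.
Proof.
move=> hc; have [|M h] := hc (m z + 1); first by have := modulus_ge0 m z; lra.
by apply: holomorphic_pseries h _; lra.
Qed.

End Entire.

(** * The infinite product as a power series *)

Section QPochhammer.
Variables (R : realType) (K : numFieldType) (m : real_modulus R K).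
Variable q : K.
Hypotheses (q0 : q != 0) (q1 : m q < 1).
Implicit Types (a v w x y z l : K) (u c d : nat -> K) (r s e M : R).

Lemma one_subX_neq0 k : 1 - q ^+ k.+1 != 0.
Proof.
rewrite subr_eq0; apply/eqP => /(congr1 m); rewrite modulus1 modulusX => E.
have := exprn_ilt1 k.+1 (modulus_ge0 m q) q1; by rewrite -E ltxx.
Qed.

Lemma one_subX_ge k : 1 - m q <= m (1 - q ^+ k.+1).
Proof.
have := modulusD m (1 - q ^+ k.+1) (q ^+ k.+1); rewrite subrK modulus1 modulusX => h.
have : m q ^+ k.+1 <= m q by rewrite exprS ler_piMr ?modulus_ge0 // exprn_ile1 ?modulus_ge0 // ltW.
lra.
Qed.

Lemma expq_inj : injective (fun i => q ^+ i).
Proof.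
move=> i j /= E; wlog lij : i j E / (i < j)%N.
  by move=> H; have [lt|lt|//] := ltngtP i j; [|apply/esym]; apply: H.
have := one_subX_neq0 (j - i.+1); rewrite -subSn // subSS subr_eq0.
rewrite -(inj_eq (mulIf (expf_neq0 i q0))) -exprD subnK ?(ltnW lij) //.
by rewrite mul1r E eqxx.
Qed.

(** Euler's expansion of the infinite product (z;q)_oo, given by the recurrence
    that makes [eulerS] hold coefficientwise. *)
Fixpoint euler_coef k : K :=
  if k is i.+1 then - q ^+ i / (1 - q ^+ i.+1) * euler_coef i else 1.

Definition euler z := pseries euler_coef z.

Lemma euler_coefS i : (1 - q ^+ i.+1) * euler_coef i.+1 = - q ^+ i * euler_coef i.
Proof. by rewrite /= mulrA mulrCA mulfV ?one_subX_neq0 // mulr1. Qed.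

Lemma modulus_euler_coefS k :
  m (euler_coef k.+1) <= (1 - m q)^-1 * m q ^+ k * m (euler_coef k).
Proof.
rewrite /= !modulusM modulusN modulusV modulusX ler_wpM2r ?modulus_ge0 //.
rewrite mulrC ler_wpM2r ?exprn_ge0 ?modulus_ge0 //.
have q1' : 0 < 1 - m q by rewrite subr_gt0.
rewrite lef_pV2 ?posrE ?one_subX_ge //; exact: lt_le_trans q1' (one_subX_ge _).
Qed.

Lemma entire_euler : entire m euler_coef.
Proof.
have q1' : 0 <= (1 - m q)^-1 by rewrite invr_ge0 subr_ge0 ltW.
apply: (@entire_of_recurrence _ _ _ _ q (1 - m q)^-1) => // k.
apply: le_trans (modulus_euler_coefS _) _.
apply: ler_pM; rewrite ?mulr_ge0 ?exprn_ge0 ?modulus_ge0 //; last first.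
  by rewrite lerDl modulus_ge0.
by rewrite ler_wpM2l // exprS ler_piMl ?exprn_ge0 ?modulus_ge0 // ltW.
Qed.

(** Iterating this equation splits off the finite products [qpoch q z n]; since
    the remaining factor tends to 1, the series is the limit of the products, and
    the limit exists. *)
Lemma eulerS z : euler z = (1 - z) * euler (q * z).
Proof.
have h := entire_euler (modulus_ge0 m z).
have hq := sums_to_scale (ltW q1) h.
rewrite mulrBl mul1r -mulN1r.
have [_ <-] := sums_toD hq (sums_toZ (-1) (sums_to_shift hq)).
congr pseries; apply/funext => -[|n].
  by rewrite /shift1 mulr0 addr0 expr0 mul1r.
have := euler_coefS n; rewrite mulrBl mul1r => /eqP.
by rewrite subr_eq => /eqP {1}->; rewrite mulN1r mulNr addrC.
Qed.

Lemma qpochS x n : qpoch q x n.+1 = qpoch q x n * (1 - x * q ^+ n).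
Proof. by rewrite /qpoch big_ord_recr. Qed.

Lemma qpoch0 x : qpoch q x 0 = 1. Proof. by rewrite /qpoch big_ord0. Qed.

Lemma euler_qpoch z n : euler z = qpoch q z n * euler (z * q ^+ n).
Proof.
elim: n => [|n ->]; first by rewrite qpoch0 mul1r expr0 mulr1.
rewrite qpochS eulerS [LHS]mulrA; congr (_ * euler _); by rewrite exprS; ring.
Qed.

Lemma euler_cvg1 z : (fun n => euler (z * q ^+ n)) @ \oo --> (1 : K).
Proof.
apply: (pseries_cvg0 ltr01 (entire_euler ler01)).
rewrite -(mulr0 z); apply: cvgM; [exact: cvg_cst|exact: cvg_exp0 q1].
Qed.

Lemma euler_tail_neq0 z : exists N, forall n, (N <= n)%N -> euler (z * q ^+ n) != 0.
Proof.
have /(modulus_cvgP m) /(_ _ ltr01) [N hN] := euler_cvg1 z.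
exists N => n /hN h; apply/eqP => E; move: h.
by rewrite E sub0r modulusN modulus1 ltxx.
Qed.

Lemma qpoch_cvg z : qpoch q z @ \oo --> euler z.
Proof.
have [N hN] := euler_tail_neq0 z.
apply: (cvg_eventually (v := fun n => euler z / euler (z * q ^+ n)) (N := N)).
  by move=> n /hN h; rewrite (euler_qpoch z n) mulfK.
rewrite -[X in _ --> X]mulr1 -invr1; apply: cvgM; first exact: cvg_cst.
by apply: cvgV; [exact: oner_neq0|exact: euler_cvg1].
Qed.

Lemma qpoch_infE z : qpoch_inf q z = euler z.
Proof. by apply: cvg_lim => //; apply: qpoch_cvg. Qed.

Lemma qpoch_neq0 z n : (forall k, z * q ^+ k != 1) -> qpoch q z n != 0.
Proof.
by move=> h; apply/prodf_neq0 => i _; rewrite subr_eq0 eq_sym.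
Qed.

(** A tail of the product is close to 1, so only a factor can vanish. *)
Lemma euler_neq0 z : (forall k, z * q ^+ k != 1) -> euler z != 0.
Proof.
move=> h; have [N hN] := euler_tail_neq0 z.
by rewrite (euler_qpoch z N) mulf_neq0 ?qpoch_neq0 ?hN.
Qed.

Lemma qpoch_bounded z : exists2 B, 0 < B & forall n, m (qpoch q z n) <= B.
Proof. exact: cvg_bounded (@qpoch_cvg z). Qed.

Lemma qpochV_bounded z : (forall k, z * q ^+ k != 1) ->
  exists2 B, 0 < B & forall n, m (qpoch q z n)^-1 <= B.
Proof.
move=> h; have := cvg_bounded m (cvgV (euler_neq0 h) (@qpoch_cvg z)).
by case=> B B0 hB; exists B.
Qed.

End QPochhammer.

(** * Meromorphic continuation of the basic hypergeometric series *)

Section Continuation.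
Variables (R : realType) (K : numFieldType) (m : real_modulus R K).
Variable q : K.
Hypotheses (q0 : q != 0) (q1 : m q < 1).
Variables A B c : K.
Let C := c * q.
Hypothesis hC : forall k, C * q ^+ k != 1.
Implicit Types (w x y z l : K) (u v d : nat -> K) (r s e M : R).

(** The lower parameter is written [C = c * q] so that the q-difference equation of
    the series involves no division by [q]. *)
Definition phi_coef n := qpoch q A n * qpoch q B n / (qpoch q C n * qpoch q q n).

Let qq k : q * q ^+ k != 1.
Proof. by rewrite -exprS eq_sym -subr_eq0 (one_subX_neq0 q1). Qed.

Let m1 : m q <= 1. Proof. exact: ltW. Qed.
Let m2 : m (q ^+ 2) <= 1. Proof. by rewrite modulusX exprn_ile1 ?modulus_ge0. Qed.

Let sqrX n : (q ^+ 2) ^+ n = q ^+ n * q ^+ n.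
Proof. by rewrite exprAC expr2. Qed.

Lemma phi_coefS n : (1 - q ^+ n.+1) * (1 - C * q ^+ n) * phi_coef n.+1 =
  (1 - A * q ^+ n) * (1 - B * q ^+ n) * phi_coef n.
Proof.
rewrite /phi_coef !qpochS -exprS.
have h1 : qpoch q C n != 0 by apply: qpoch_neq0.
have h2 : qpoch q q n != 0 by apply: qpoch_neq0.
have h3 : 1 - C * q ^+ n != 0 by rewrite subr_eq0 eq_sym.
have h4 := one_subX_neq0 q1 n.
by field; rewrite h1 h2 h3 h4.
Qed.

Lemma phi_converges r : 0 <= r -> r < 1 -> converges_at m phi_coef r.
Proof.
move=> r0 r1.
have [BA BA0 hA] := qpoch_bounded q1 A; have [BB BB0 hB] := qpoch_bounded q1 B.
have [BC BC0 hC'] := qpochV_bounded q1 hC; have [BQ BQ0 hQ] := qpochV_bounded q1 qq.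
eexists; apply: (majorized_geometric r0 r1) => n.
rewrite expr1n mulr1 /phi_coef invfM !modulusM.
by apply: ler_pM (ler_pM _ _ (hA n) (hB n)) (ler_pM _ _ (hC' n) (hQ n));
  rewrite ?mulr_ge0 ?modulus_ge0.
Qed.

(** The coefficients of the numerator of the continuation: multiplication by
    (z;q)_oo removes the poles. *)
Definition phi_num : nat -> K := conv (euler_coef q) phi_coef.

Lemma phi_num_converges r : 0 <= r -> r < 1 -> converges_at m phi_num r.
Proof.
move=> r0 r1; have [M h] := entire_euler q1 r0; have [M' h'] := phi_converges r0 r1.
by exists (M * M'); apply: majorized_conv.
Qed.

Lemma phi_numE z : m z < 1 -> pseries phi_num z = euler q z * pseries phi_coef z.
Proof.
move=> z1; have [M h] := entire_euler q1 (modulus_ge0 m z).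
have [M' h'] := phi_converges (modulus_ge0 m z) z1.
exact: pseries_conv h h' (lexx _).
Qed.

Let scale x d : nat -> K := fun n => x ^+ n * d n.

(** The first-order recurrence of the coefficients, read as a second-order
    q-difference equation. *)
Lemma phi_series_qdiff z : m z < 1 -> (1 - z) * pseries phi_coef z =
  (1 + c - (A + B) * z) * pseries phi_coef (q * z) +
  (A * B * z - c) * pseries phi_coef (q ^+ 2 * z).
Proof.
move=> z1; have h := phi_converges (modulus_ge0 m z) z1.
have h1 := sums_to_pseries h.
have hq := sums_to_scale m1 h; have hqq := sums_to_scale m2 h.
set F := pseries phi_coef z in h1 *.
set G := pseries _ (q * z) in hq *; set H := pseries _ (q ^+ 2 * z) in hqq *.
have -> : (1 + c - (A + B) * z) * G + (A * B * z - c) * H =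
   ((1 + c) * G + - (A + B) * (z * G)) + (A * B * (z * H) + - c * H) by ring.
have -> : (1 - z) * F = F + - 1 * (z * F) by ring.
have [_ <-] := sums_toD h1 (sums_toZ (-1) (sums_to_shift h1)).
have [_ <-] := sums_toD
  (sums_toD (sums_toZ (1 + c) hq) (sums_toZ (- (A + B)) (sums_to_shift hq)))
  (sums_toD (sums_toZ (A * B) (sums_to_shift hqq)) (sums_toZ (- c) hqq)).
congr pseries; apply/funext => -[|n] /=; first by rewrite expr0; ring.
have := phi_coefS n; rewrite /C => E.
apply/eqP; rewrite -subr_eq0; apply/eqP; move/eqP: E; rewrite -subr_eq0 => /eqP <-.
by rewrite !sqrX !exprS; ring.
Qed.

(** The coefficients of the right-hand side of the q-difference equation
    satisfied by [euler q z * pseries phi_coef z]. *)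
Let step d n : K :=
  ((1 + c) * scale q d n + - (A + B) * shift1 (scale q d) n) +
  (((A * B + C) * shift1 (scale (q ^+ 2) d) n + - c * scale (q ^+ 2) d n) +
   - (A * B * q) * shift1 (shift1 (scale (q ^+ 2) d)) n).

Let sums_to_step d z : converges_at m d (m z) -> sums_to m (step d) z
  ((1 + c - (A + B) * z) * pseries d (q * z) +
   (A * B * z - c) * (1 - q * z) * pseries d (q ^+ 2 * z)).
Proof.
move=> h; have hq := sums_to_scale m1 h; have hqq := sums_to_scale m2 h.
set G := pseries _ _ in hq *; set H := pseries _ (q ^+ 2 * z) in hqq *.
have -> : (1 + c - (A + B) * z) * G + (A * B * z - c) * (1 - q * z) * H =
  ((1 + c) * G + - (A + B) * (z * G)) + (((A * B + C) * (z * H) + - c * H) +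
   - (A * B * q) * (z * (z * H))) by rewrite /C; ring.
apply: sums_toD (sums_toD (sums_toZ _ hq) (sums_toZ _ (sums_to_shift hq))) _.
apply: sums_toD (sums_toD (sums_toZ _ (sums_to_shift hqq)) (sums_toZ _ hqq)) _.
exact: sums_toZ _ (sums_to_shift (sums_to_shift hqq)).
Qed.

Lemma phi_num_qdiff_disc z : m z < 1 -> pseries phi_num z =
  (1 + c - (A + B) * z) * pseries phi_num (q * z) +
  (A * B * z - c) * (1 - q * z) * pseries phi_num (q ^+ 2 * z).
Proof.
move=> z1.
have lt1 x : m x <= 1 -> m (x * z) < 1.
  move=> hx; apply: le_lt_trans z1; rewrite modulusM.
  by rewrite -[leRHS]mul1r ler_wpM2r ?modulus_ge0.
rewrite !phi_numE ?lt1 // (eulerS q1 z) [LHS]mulrAC phi_series_qdiff //.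
by rewrite (eulerS q1 (q * z)) [q * (q * z)]mulrA -expr2; ring.
Qed.

(** The q-difference equation is known on the unit disc only, but there it determines
    the coefficients, and these carry it to the whole plane. *)
Lemma phi_num_step n : phi_num n = step phi_num n.
Proof.
have h0 : (0 : R) <= 1 / 2 by lra.
have h1 : (1 / 2 : R) < 1 by lra.
have [M h] := phi_num_converges h0 h1.
have mh : m (embed m (1 / 2)) = 1 / 2 by rewrite modulus_embed.
have hD := phi_num_converges h0 h1; rewrite -mh in hD.
have [[M' h'] _] := sums_to_step hD; rewrite mh in h'.
apply: (@pseries_inj _ _ m _ _ (1 / 2) _ _ _ h h'); first by lra.
move=> w w2; have [|_ ->] := @sums_to_step phi_num w.
  by apply: phi_num_converges; rewrite ?modulus_ge0 //; lra.
by rewrite phi_num_qdiff_disc //; lra.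
Qed.

Lemma phi_numSS k : (1 - q ^+ k.+2) * (1 - c * q ^+ k.+2) * phi_num k.+2 =
  q ^+ k.+1 * ((- (A + B) + (A * B + C) * q ^+ k.+1) * phi_num k.+1 - A * B * q ^+ k * phi_num k).
Proof.
have := phi_num_step k.+2; rewrite /step /scale /shift1 /C.
move: (phi_num k.+2) (phi_num k.+1) (phi_num k) => x y z E.
apply/eqP; rewrite -subr_eq0; apply/eqP; move/eqP: E; rewrite -subr_eq0 => /eqP <-.
by rewrite !sqrX !exprS; ring.
Qed.

Lemma phi_num0 : phi_num 0 = 1.
Proof. by rewrite /phi_num /conv big_ord1 /phi_coef /= !qpoch0 !mul1r invr1. Qed.

Lemma phi_num1 : (1 - q) * (1 - C) * phi_num 1 = - (A + B) + (A * B + C).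
Proof.
have := phi_num_step 1; rewrite /step /scale /shift1 /C phi_num0.
move: (phi_num 1) => x E; apply/eqP; rewrite -subr_eq0; apply/eqP.
by move/eqP: E; rewrite -subr_eq0 => /eqP <-; rewrite !expr1 !expr0; ring.
Qed.

(** The recurrence [phi_numSS] has the factor [q ^+ k.+1] on its right-hand side. *)
Lemma entire_phi_num : entire m phi_num.
Proof.
pose x n : K := (1 - q ^+ n.+1) * (1 - C * q ^+ n).
have x0 n : x n != 0 by rewrite mulf_neq0 ?(one_subX_neq0 q1) // subr_eq0 eq_sym.
have xc : x @ \oo --> (1 : K).
  rewrite -[X in _ --> X]mulr1; apply: cvgM.
    rewrite -[X in _ --> X]subr0; apply: cvgB; first exact: cvg_cst.
    under eq_fun do rewrite exprS.
    by rewrite -(mulr0 q); apply: cvgM; [exact: cvg_cst|exact: cvg_exp0 q1].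
  rewrite -[X in _ --> X]subr0; apply: cvgB; first exact: cvg_cst.
  by rewrite -(mulr0 C); apply: cvgM; [exact: cvg_cst|exact: cvg_exp0 q1].
have [P P0 hP] := cvg_bounded m (cvgV (oner_neq0 K) xc).
pose L := m (A + B) + m (A * B + C) + m (A * B).
have L0 : 0 <= L by rewrite !addr_ge0 ?modulus_ge0.
apply: (@entire_of_recurrence _ _ _ _ q (P * L)) => //; first by rewrite mulr_ge0 // ltW.
have qk k : m (q ^+ k) <= 1 by rewrite modulusX exprn_ile1 ?modulus_ge0.
move=> k; have := phi_numSS k.
rewrite -[c * q ^+ k.+2]/(c * (q * q ^+ k.+1)) mulrA -/C -/(x k.+1).
move=> /(congr1 (fun y => (x k.+1)^-1 * y)); rewrite mulKf // => ->.
rewrite modulusM; set X := q ^+ k.+1 * _.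
apply: (@le_trans _ _ (P * (L * m q ^+ k * (m (phi_num k.+1) + m (phi_num k))))); last first.
  by rewrite !mulrA.
apply: ler_pM; rewrite ?modulus_ge0 //; first exact: hP.
have h1 : m (q ^+ k.+1) <= m q ^+ k.
  by rewrite modulusX exprS ler_piMl ?exprn_ge0 ?modulus_ge0.
have h2 : m (- (A + B) + (A * B + C) * q ^+ k.+1) <= L.
  apply: le_trans (modulusD _ _ _) _; rewrite modulusN /L modulusM.
  have := ler_piMr (modulus_ge0 m (A * B + C)) (qk k.+1); have := modulus_ge0 m (A * B); lra.
have h3 : m (A * B * q ^+ k) <= L.
  rewrite modulusM; have := ler_piMr (modulus_ge0 m (A * B)) (qk k); rewrite /L.
  have := modulus_ge0 m (A + B); have := modulus_ge0 m (A * B + C); lra.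
rewrite [leRHS](_ : _ = m q ^+ k * (L * m (phi_num k.+1) + L * m (phi_num k))); last by ring.
rewrite /X modulusM; apply: ler_pM; rewrite ?modulus_ge0 //.
apply: le_trans (modulusB _ _ _) _; rewrite [m (_ * phi_num k.+1)]modulusM.
by rewrite [m (_ * phi_num k)]modulusM lerD // ler_wpM2r ?modulus_ge0.
Qed.

Lemma phi_num_qdiff z : pseries phi_num z =
  (1 + c - (A + B) * z) * pseries phi_num (q * z) +
  (A * B * z - c) * (1 - q * z) * pseries phi_num (q ^+ 2 * z).
Proof.
have [|_ <-] := @sums_to_step phi_num z; first by apply: entire_phi_num; apply: modulus_ge0.
by congr pseries; apply/funext => n; apply: phi_num_step.
Qed.

Definition phi_fun z := pseries phi_num z / euler q z.

Lemma phi21_polesP y : ~ phi21_poles q y <-> forall k, y * q ^+ k != 1.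
Proof.
have qk k : q ^+ k != 0 by rewrite expf_neq0.
split=> [h k|h [k]]; [apply/eqP => E; apply: h; exists k|move=> E].
  by apply: (mulIf (qk k)); rewrite E mulVf.
by have := h k; rewrite E mulVf ?eqxx.
Qed.

Lemma phi_fun_qdiff w : ~ phi21_poles q w -> (1 - w) * phi_fun w =
  (1 + c - (A + B) * w) * phi_fun (q * w) + (A * B * w - c) * phi_fun (q ^+ 2 * w).
Proof.
move/phi21_polesP => h; rewrite /phi_fun.
have e2 : euler q (q ^+ 2 * w) != 0.
  by apply: (euler_neq0 q1) => k; rewrite mulrAC -exprD mulrC h.
have h0 : 1 - w != 0 by have := h 0%N; rewrite expr0 mulr1 eq_sym subr_eq0.
have h1 : 1 - q * w != 0 by have := h 1%N; rewrite expr1 eq_sym subr_eq0 mulrC.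
rewrite (phi_num_qdiff w) (eulerS q1 w) (eulerS q1 (q * w)) [q * (q * w)]mulrA -expr2.
by field; rewrite e2 h0 h1.
Qed.

Lemma holomorphic_euler z : holomorphic_at (euler q) z.
Proof. exact: holomorphic_entire (entire_euler q1). Qed.

Lemma holomorphic_qpoch n z : holomorphic_at (fun w => qpoch q w n) z.
Proof.
elim: n => [|n IH].
  by under eq_fun do rewrite qpoch0; apply: (holomorphic_cst m).
under eq_fun do rewrite qpochS.
apply: (holomorphicM m) => //.
under eq_fun do rewrite -mulrN mulrC addrC.
exact: (holomorphic_affine m).
Qed.

Lemma phi_fun_continuation : phi21_continuation q A B C phi_fun.
Proof.
have hol y : ~ phi21_poles q y -> holomorphic_at phi_fun y.
  move/phi21_polesP => hy; apply: (holomorphicM m).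
    exact: holomorphic_entire entire_phi_num.
  by apply: (holomorphicV m); [exact: (euler_neq0 q1)|exact: holomorphic_euler].
split=> // y.
  move=> y1; have {}y1 : m y < 1.
    by rewrite -(embed_lt m) embed_modulus rmorph1.
  rewrite /phi_fun phi_numE // mulrAC mulfV ?mul1r //.
  apply: (euler_neq0 q1) => k; apply/eqP => /(congr1 m); rewrite modulusM modulusX modulus1.
  have : m q ^+ k <= 1 by rewrite exprn_ile1 ?modulus_ge0.
  have := modulus_ge0 m y; have : 0 <= m q ^+ k by rewrite exprn_ge0 ?modulus_ge0.
  nra.
have [[k yk]|/hol hy] := pselect (phi21_poles q y); last first.
  by apply: (@holomorphic_meromorphic _ phi_fun phi_fun y 0) => // w _; rewrite mul1r.
have qk : q ^+ k != 0 by rewrite expf_neq0.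
(* At [q ^- k] exactly one factor of the denominator vanishes, [1 - w * q ^+ k],
   so the pole is at most simple. *)
pose g w := pseries phi_num w / (- q ^+ k * (qpoch q w k * euler q (w * q ^+ k.+1))).
apply: (@holomorphic_meromorphic _ phi_fun g y 1).
  apply: (holomorphicM m); first exact: holomorphic_entire entire_phi_num.
  apply: (holomorphicV m).
    rewrite !mulf_neq0 ?oppr_eq0 //.
      apply/prodf_neq0 => i _; rewrite yk subr_eq0 eq_sym; apply/eqP => E.
      have E' : q ^+ k = q ^+ i by rewrite -[RHS](mulVKf qk) E mulr1.
      by have := ltn_ord i; rewrite -(expq_inj q0 q1 E') ltnn.
    apply: (euler_neq0 q1) => j; rewrite yk exprS mulrCA mulVf // mulr1; exact: qq.
  apply: (holomorphicM m); first exact: (holomorphic_cst m).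
  apply: (holomorphicM m); first exact: holomorphic_qpoch.
  apply: (holomorphic_comp m (g := euler q)); first exact: holomorphic_euler.
  under eq_fun do rewrite mulrC -[_ * _]addr0.
  exact: (holomorphic_affine m).
move=> w wy; rewrite expr1 /phi_fun /g (euler_qpoch q1 w k.+1) qpochS.
have -> : 1 - w * q ^+ k = - q ^+ k * (w - y).
  by rewrite yk; field.
rewrite !invfM; have : w - y != 0 by rewrite subr_eq0.
set e := (euler _ _)^-1; set p := (qpoch _ _ _)^-1 => wy0.
by field; rewrite qk wy0.
Qed.

End Continuation.

(** * Theta functions *)

Section Theta.
Variables (R : realType) (K : numFieldType) (m : real_modulus R K).
Variable q : K.
Hypotheses (q0 : q != 0) (q1 : m q < 1).
Implicit Types (w x y z : K) (r : R).

Definition tri n : K := q ^+ 'C(n, 2).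

Lemma triS n : tri n.+1 = tri n * q ^+ n.
Proof. by rewrite /tri binS bin1 exprD. Qed.

Lemma tri0 : tri 0 = 1. Proof. by []. Qed.

Lemma entire_tri : entire m tri.
Proof.
apply: (@entire_of_recurrence _ _ _ _ q 1) => // k.
rewrite mul1r triS modulusM modulusX mulrC.
apply: ler_pM; rewrite ?exprn_ge0 ?modulus_ge0 //; last by rewrite lerDl modulus_ge0.
by rewrite exprS ler_piMl ?exprn_ge0 ?modulus_ge0 // ltW.
Qed.

Lemma entire_tail (c : nat -> K) n : entire m c -> entire m (fun i => c (n + i)%N).
Proof.
move=> hc r r0; have [|M h] := hc (r + 1); first by lra.
have r1 : 0 < r + 1 by lra.
exists (M / (r + 1) ^+ n); apply: majorized_le (majorized_shift n r1 h); lra.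
Qed.

Lemma entire_tri1 : entire m (fun n => tri n.+1).
Proof. exact: entire_tail 1%N entire_tri. Qed.

Lemma entire_tri2 : entire m (fun n => tri n.+2).
Proof. exact: entire_tail 2%N entire_tri. Qed.

Lemma thetaE x : theta q x = pseries tri x + x^-1 * pseries (fun n => tri n.+2) x^-1.
Proof.
rewrite /theta; congr (_ + _).
have [M h] := entire_tri2 (modulus_ge0 m x^-1).
rewrite -(tsumZ _ (pseries_bounded h (lexx _))); congr tsum.
by apply/funext => n; rewrite mulrCA -exprS exprVn.
Qed.

(** The substitution of [q * x] moves every term of the bilateral series by one
    place; the constant term 1 passes from one half to the other. *)
Lemma theta_shift x : x != 0 -> theta q x = x * theta q (q * x).
Proof.
move=> x0; rewrite !thetaE; set y := x^-1.
have -> : (q * x)^-1 = q^-1 * y by rewrite invfM.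
have E1 : pseries tri x = 1 + x * pseries tri (q * x).
  have [M h] := entire_tri (ler_wpDl ler01 (modulus_ge0 m x)).
  rewrite (pseries_shift 1 _ h); [|by have := modulus_ge0 m x; lra|by lra].
  rewrite big_ord1 mulr1 tri0 expr1 pseries_scale; congr (_ + _ * pseries _ _).
  by apply/funext => n; rewrite add1n triS mulrC.
have E2 : q^-1 * y * pseries (fun n => tri n.+2) (q^-1 * y) =
    y * (1 + y * pseries (fun n => tri n.+2) y).
  have [M h] := entire_tri1 (ler_wpDl ler01 (modulus_ge0 m y)).
  have -> : 1 + y * pseries (fun n => tri n.+2) y = pseries (fun n => tri n.+1) y.
    rewrite (pseries_shift 1 _ h); [|by have := modulus_ge0 m y; lra|by lra].
    by rewrite big_ord1 mulr1 expr1.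
  rewrite -mulrA mulrCA; congr (_ * _).
  have [M' h'] := entire_tri2 (modulus_ge0 m (q^-1 * y)).
  rewrite -(pseriesZ _ h' (lexx _)) pseries_scale; congr pseries.
  apply/funext => n; rewrite triS exprS exprVn.
  by field; rewrite ?q0 expf_neq0.
by rewrite E1 E2 /y; field.
Qed.

Lemma theta_shiftn x n : x != 0 -> theta q x = tri n * x ^+ n * theta q (q ^+ n * x).
Proof.
move=> x0; elim: n => [|n ->]; first by rewrite tri0 !mul1r.
rewrite (@theta_shift (q ^+ n * x)) ?mulf_neq0 ?expf_neq0 //.
by rewrite [q * (q ^+ n * x)]mulrA -exprS triS [x ^+ n.+1]exprS; ring.
Qed.

Lemma holomorphic_theta x : x != 0 -> holomorphic_at (theta q) x.
Proof.
move=> x0; rewrite (funext thetaE).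
apply: (holomorphicD m); first exact: holomorphic_entire entire_tri.
apply: (holomorphicM m); first exact: (holomorphic_inv m).
apply: (holomorphic_comp m); last exact: (holomorphic_inv m).
exact: holomorphic_entire entire_tri2.
Qed.

End Theta.

Lemma real_absolutely_summable_cvg (R : realType) (u : nat -> R) (B : R) :
  (forall N, \sum_(i < N) `|u i| <= B) -> cvgn (series u).
Proof.
move=> h; have : cvgn (series (fun n => `|u n|)); last exact: normed_cvg.
apply: nondecreasing_is_cvgn.
  by apply/nondecreasing_seqP => n; rewrite !seriesE big_ord_recr /= lerDl.
by exists B => _ [N _ <-]; rewrite seriesE.
Qed.

Definition real_self_modulus (R : realType) : real_modulus R R :=
  @RealModulus R R (fun x => `|x|) idfun (fun _ _ => erefl) (fun _ => erefl)
    (@real_absolutely_summable_cvg R).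

Section ThetaBound.
Variables (R : realType) (K : numFieldType) (m : real_modulus R K).
Variable q : K.
Hypotheses (q0 : q != 0) (q1 : m q < 1).
Implicit Types (w x y z : K).

Let mr := real_self_modulus R.
Let Q : R := m q.
Let Q0 : Q != 0. Proof. by rewrite modulus_eq0. Qed.
Let Q1 : mr Q < 1. Proof. by rewrite /= ger0_norm ?modulus_ge0. Qed.

Let nonneg_pseries (c : nat -> R) r N : entire mr c -> (forall n, 0 <= c n) -> 0 <= r ->
  \sum_(i < N) c i * r ^+ i <= pseries c r.
Proof.
move=> hc c0 r0; have [M h] := hc `|r| (normr_ge0 r).
have /tsum_cvg hs := pseries_bounded h (lexx _).
have := nondecreasing_cvgn_le _ (cvgP _ hs) N.
rewrite (cvg_lim _ hs) // seriesE; apply; apply/nondecreasing_seqP => n.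
by rewrite !seriesE big_ord_recr /= lerDl mulr_ge0 ?exprn_ge0.
Qed.

(** The moduli of the terms of the bilateral series are the terms of the theta
    series of base [m q] at [m x], which is therefore an exact majorant, with the
    same quasi-periodicity. *)
Lemma theta_bound x : x != 0 ->
  sum_bounded (m \o (fun n => tri q n * x ^+ n)) (theta Q (m x)) /\
  sum_bounded (m \o (fun n => tri q n.+2 * x^-1 ^+ n.+1)) (theta Q (m x)).
Proof.
move=> x0; have mx : 0 < m x by rewrite modulus_gt0.
have t0 n : 0 <= tri Q n by rewrite exprn_ge0 ?modulus_ge0.
have p1 N := nonneg_pseries N (entire_tri Q1) t0 (ltW mx).
have ix : 0 <= (m x)^-1 by rewrite invr_ge0 ltW.
have p2 N := nonneg_pseries N (entire_tri2 Q1) (fun n => t0 n.+2) ix.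
have P1 : 0 <= pseries (tri Q) (m x) by have := p1 0%N; rewrite big_ord0.
have P2 : 0 <= pseries (fun n => tri Q n.+2) (m x)^-1 by have := p2 0%N; rewrite big_ord0.
split=> N; rewrite (thetaE Q1).
  apply: le_trans (_ : pseries (tri Q) (m x) <= _); last by rewrite lerDl mulr_ge0.
  apply: le_trans (p1 N); apply: ler_sum => i _ /=.
  by rewrite modulusM !modulusX.
rewrite (@le_trans _ _ ((m x)^-1 * pseries (fun n => tri Q n.+2) (m x)^-1)) ?lerDr //.
apply: le_trans (ler_wpM2l ix (p2 N)); rewrite mulr_sumr; apply: ler_sum => i _ /=.
by rewrite modulusM !modulusX modulusV exprS mulrCA.
Qed.

Lemma theta_bound_shift x n : x != 0 ->
  theta Q (m x) = m (tri q n * x ^+ n) * theta Q (m (q ^+ n * x)).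
Proof.
move=> x0; rewrite (@theta_shiftn _ _ mr Q Q0 Q1 (m x) n) ?modulus_eq0 //.
by rewrite !modulusM !modulusX.
Qed.

End ThetaBound.

(** * Partial fractions at the nodes of two geometric progressions *)

Section Lagrange.
Variables (F : fieldType) (I : finType) (x : I -> F).
Hypothesis x_inj : injective x.

(** The leading coefficients of the two sides of Lagrange's interpolation
    formula. *)
Lemma lagrange_sum (P : {poly F}) : (size P <= #|I|)%N ->
  \sum_i P.[x i] / \prod_(j | j != i) (x i - x j) = P`_#|I|.-1.
Proof.
move=> sP.
pose D i := \prod_(j | j != i) (x i - x j).
pose W i := \prod_(j | j != i) ('X - (x j)%:P).
have D0 i : D i != 0.
  by apply/prodf_neq0 => j ji; rewrite subr_eq0 (inj_eq x_inj) eq_sym.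
have sW i : size (W i) = #|I|.
  rewrite size_prod => [|j _]; last by rewrite polyXsubC_eq0.
  rewrite (eq_bigr (fun=> 2%N)) => [|j _]; last by rewrite size_XsubC.
  have I0 : (0 < #|I|)%N by apply/card_gt0P; exists i.
  rewrite sum_nat_const (@eq_card _ _ (predC1 i)) // cardC1; lia.
pose L := \sum_i (P.[x i] / D i) *: W i.
have Wx i k : (W i).[x k] = if k == i then D i else 0.
  rewrite horner_prod; case: eqP => [->|/eqP ki].
    by apply: eq_bigr => j _; rewrite hornerXsubC.
  by rewrite (bigD1 k) //= hornerXsubC subrr mul0r.
have Lx k : L.[x k] = P.[x k].
  rewrite horner_sum (bigD1 k) //= big1 => [|i ik]; last first.
    by rewrite hornerZ Wx eq_sym (negPf ik) mulr0.
  by rewrite hornerZ Wx eqxx divfK ?addr0.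
have sL : (size L <= #|I|)%N.
  apply: leq_trans (size_sum _ _ _) _; apply/bigmax_leqP => i _.
  by apply: leq_trans (size_scale_leq _ _) _; rewrite sW.
have -> : P = L.
  apply/eqP; rewrite -subr_eq0; apply/negPn/negP => PL0.
  have := @max_poly_roots _ (P - L) [seq x i | i <- enum I] PL0.
  rewrite size_map -cardE map_inj_uniq // enum_uniq.
  have -> : all (root (P - L)) [seq x i | i <- enum I].
    by apply/allP => _ /mapP [k _ ->]; rewrite rootE hornerD hornerN Lx subrr.
  move=> /(_ isT isT); rewrite ltnNge; apply/negP; rewrite negbK.
  by apply: leq_trans (size_polyD _ _) _; rewrite geq_max size_polyN sP.
rewrite coef_sum; apply: eq_bigr => i _; rewrite coefZ Lx.
have /monicP : W i \is monic by apply: monic_prod_XsubC.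
by rewrite lead_coefE sW => ->; rewrite mulr1.
Qed.

End Lagrange.

Section Residues.
Variables (R : realType) (K : numFieldType) (m : real_modulus R K).
Variable q : K.
Hypotheses (q0 : q != 0) (q1 : m q < 1).
Implicit Types (A B x y z : K).

Local Notation qp := (qpoch q).
Local Notation tri := (tri q).

Let qq k : q * q ^+ k != 1.
Proof. by rewrite -exprS eq_sym -subr_eq0 (one_subX_neq0 q1). Qed.

Lemma prod_progression x y j : y != 0 ->
  \prod_(i < j) (x * q ^+ j - y * q ^+ i) = (- y) ^+ j * tri j * qp (q * x / y) j.
Proof.
move=> y0; elim: j => [|j IH]; first by rewrite big_ord0 qpoch0 tri0 !mulr1.
rewrite big_ord_recl /= expr0 mulr1.
rewrite (eq_bigr (fun i : 'I_j => q * (x * q ^+ j - y * q ^+ i))) => [|i _]; last first.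
  by rewrite /bump /= add1n !exprS; ring.
rewrite big_split /= prodr_const card_ord IH qpochS triS !exprS.
by field.
Qed.

(** Up to a factor independent of [j], the coefficient R_j of 1/(1 - A q^j t) in the
    partial fraction expansion of (ABt;q)_oo / ((At;q)_oo (Bt;q)_oo). *)
Definition residue_coef A B j :=
  (- A) ^+ j * tri j.+1 * (qp (q / B) j / (qp q j * qp (A / B * q) j)).

(** The coefficient R_j itself for the products cut at [N] factors, in terms of the
    nodes 1/t: it is the weight of the node [A * q ^+ j] in Lagrange's formula. *)
Definition residue_finite A B N j :=
  (A * q ^+ j) ^+ N.-1 * \prod_(l < N) (A * q ^+ j - A * B * q ^+ l) /
  ((\prod_(i < N | i != j :> nat) (A * q ^+ j - A * q ^+ i)) *
   \prod_(i < N) (A * q ^+ j - B * q ^+ i)).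

Definition nonresonant A B := forall k n, A * q ^+ k != B * q ^+ n.

Lemma nonresonant_sym A B : nonresonant A B -> nonresonant B A.
Proof. by move=> h k n; rewrite eq_sym. Qed.

Lemma nonresonant_qpoch A B : B != 0 -> nonresonant A B -> forall k, A / B * q ^+ k != 1.
Proof.
move=> B0 h k; apply/negP => /eqP E; have := h k 0%N.
by rewrite expr0 mulr1 => /negP; apply; apply/eqP; rewrite -[RHS]mulr1 -E; field.
Qed.

Lemma nonresonant_qpochS A B : B != 0 -> nonresonant A B -> forall k, A / B * q * q ^+ k != 1.
Proof. by move=> B0 h k; rewrite -mulrA -exprS; apply: nonresonant_qpoch. Qed.

Lemma exp_square j : (q ^+ j) ^+ j = tri j * tri j.+1.
Proof.
rewrite /tri -exprM -exprD; congr (_ ^+ _).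
by elim: j => // j IH; move: IH; rewrite !binS !bin1 !bin0; lia.
Qed.

Lemma residue_finiteS A B N j : (j < N)%N ->
  residue_finite A B N.+1 j = residue_finite A B N j *
  (A * q ^+ j * (A * q ^+ j - A * B * q ^+ N) /
    ((A * q ^+ j - A * q ^+ N) * (A * q ^+ j - B * q ^+ N))).
Proof.
move=> jN; rewrite /residue_finite !big_ord_recr /=.
rewrite [X in _ / (X * _)]big_mkcond big_ord_recr /= gtn_eqF //= -big_mkcond /=.
have -> : (A * q ^+ j) ^+ N = (A * q ^+ j) ^+ N.-1 * (A * q ^+ j).
  by rewrite -exprSr prednK // (leq_ltn_trans _ jN).
by rewrite !invfM; ring.
Qed.

(** The cut affects three Pochhammer symbols only. They are bounded and converge
    as the number of factors grows, so dominated convergence applies to sums over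
    [j]. *)
Lemma residue_finiteE A B j k : A != 0 -> B != 0 -> nonresonant A B ->
  residue_finite A B (j + k.+1) j =
  residue_coef A B j * (qp B k.+1 / (qp q k * qp (B / A) k.+1)).
Proof.
move=> A0 B0 hAB.
have hBA := nonresonant_qpoch A0 (nonresonant_sym hAB).
have hABq := nonresonant_qpochS B0 hAB.
have qj i : q ^+ i != 0 by rewrite expf_neq0.
have ABk i : A - B * q ^+ i != 0.
  by have := hAB 0%N i; rewrite expr0 mulr1 subr_eq0.
elim: k => [|k IH].
  rewrite /residue_finite addn1 /= !big_ord_recr /= qpoch0 mul1r !qpochS !qpoch0 !mul1r.
  rewrite [X in _ / (X * _)]big_mkcond big_ord_recr /= eqxx mulr1 -big_mkcond /=.
  rewrite [\prod_(i < j | i != j :> nat) _](eq_bigl xpredT) => [|i]; last by rewrite ltn_eqF.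
  rewrite expr0 !mulr1 (prod_progression A j (mulf_neq0 A0 B0)).
  rewrite (prod_progression A j A0) (prod_progression A j B0).
  have -> : q * A / (A * B) = q / B by field; rewrite A0 B0.
  rewrite mulfK // (_ : q * A / B = A / B * q); last by rewrite [q * A]mulrC mulrAC.
  rewrite /residue_coef exprMn exp_square -[- (A * B)]mulN1r -[- A]mulN1r -[- B]mulN1r.
  rewrite !exprMn -[in RHS]invr_sign.
  have s0 : (-1) ^+ j != 0 :> K by rewrite expf_neq0 // oppr_eq0 oner_neq0.
  have A1 := ABk 0%N; rewrite expr0 mulr1 in A1.
  have Q1 : qp q j != 0 by apply: qpoch_neq0.
  have Q2 : qp (A / B * q) j != 0 by apply: qpoch_neq0.
  have Aj : A ^+ j != 0 by rewrite expf_neq0.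
  have Bj : B ^+ j != 0 by rewrite expf_neq0.
  have T0 : tri j != 0 by rewrite expf_neq0.
  have A2 : A * q ^+ j - B * q ^+ j != 0 by rewrite subr_eq0.
  by field; rewrite A2 ?s0 ?A1 ?Q1 ?Q2 ?Aj ?Bj ?T0 ?A0 ?B0 ?qj.
rewrite addnS residue_finiteS ?IH; last by rewrite addnS ltnS leq_addr.
rewrite !qpochS exprD.
have Q1 := one_subX_neq0 q1 k; have A1 := ABk k.+1.
have Q2 : qp q k != 0 by apply: qpoch_neq0.
have Q3 : qp (B / A) k != 0 by apply: qpoch_neq0.
have A2 := ABk k.
rewrite !exprS in Q1 A1 *.
have A3 : A * q ^+ j - B * (q ^+ j * (q * q ^+ k)) != 0.
  by rewrite mulrCA [A * _]mulrC -mulrBr mulf_neq0.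
have A4 : A * q ^+ j - A * (q ^+ j * (q * q ^+ k)) != 0.
  by rewrite mulrA -{1}[A * _]mulr1 -mulrBr !mulf_neq0.
by field; rewrite A0 A1 A2 Q3 Q1 Q2 A3 A4.
Qed.


Definition residue A B j :=
  euler q B / (euler q q * euler q (B / A)) * residue_coef A B j.

Lemma residue_coefS A B j : A != 0 -> B != 0 -> nonresonant A B ->
  (1 - q ^+ j.+1) * (1 - A / B * q ^+ j.+1) * residue_coef A B j.+1 =
  - A * q ^+ j.+1 * (1 - q / B * q ^+ j) * residue_coef A B j.
Proof.
move=> A0 B0 hAB; have hABq := nonresonant_qpochS B0 hAB.
have Q1 : qp q j != 0 by apply: qpoch_neq0.
have Q2 : qp (A / B * q) j != 0 by apply: qpoch_neq0.
have Q3 := one_subX_neq0 q1 j.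
have Q4 : 1 - A / B * q ^+ j.+1 != 0.
  by rewrite subr_eq0 eq_sym exprS mulrA hABq.
rewrite /residue_coef !qpochS (triS _ j.+1) -[A / B * q * _]mulrA -!exprS.
rewrite [(- A) ^+ _]exprS.
move: Q3 Q4; set X := q ^+ j.+1 => Q3 Q4; have Q5 : B - A * X != 0.
  by rewrite -(inj_eq (mulIf (invr_neq0 B0))) mul0r mulrBl mulfV // mulrAC.
by field; rewrite Q1 Q2 Q3 Q5 B0.
Qed.

Lemma entire_bounded_mul (b c : nat -> K) x M : 0 <= M -> (forall n, m (b n) <= M) ->
  entire m c -> entire m (fun n => b n * x ^+ n * c n).
Proof.
move=> M0 hb hc r r0; have [|L hL] := hc (m x * r); first by rewrite mulr_ge0 ?modulus_ge0.
exists (M * L) => N; apply: le_trans (ler_wpM2l M0 (hL N)); rewrite mulr_sumr.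
apply: ler_sum => i _; rewrite !modulusM modulusX -!mulrA ler_pM ?modulus_ge0 //.
  by rewrite !mulr_ge0 ?exprn_ge0 ?modulus_ge0.
by rewrite exprMn mulrCA.
Qed.

Lemma residue_ratio_bounded A B : A != 0 -> B != 0 -> nonresonant A B ->
  exists2 M, 0 <= M & forall j, m (qp (q / B) j / (qp q j * qp (A / B * q) j)) <= M.
Proof.
move=> A0 B0 hAB; have hABq := nonresonant_qpochS B0 hAB.
have [M1 M10 h1] := qpoch_bounded q1 (q / B).
have [M2 M20 h2] := qpochV_bounded q1 qq.
have [M3 M30 h3] := qpochV_bounded q1 hABq.
exists (M1 * (M2 * M3)) => [|j]; first by rewrite !mulr_ge0 // ltW.
by rewrite invfM !modulusM !ler_pM ?mulr_ge0 ?modulus_ge0.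
Qed.

Lemma entire_residue_coef A B : A != 0 -> B != 0 -> nonresonant A B ->
  entire m (residue_coef A B).
Proof.
move=> A0 B0 hAB; have [M M0 hM] := residue_ratio_bounded A0 B0 hAB.
have := entire_bounded_mul (- A) M0 hM (entire_tri1 q1); congr entire.
by apply/funext => j; rewrite /residue_coef; ring.
Qed.

(** The n-th moment sum_j R_j (A q^j)^n is A^n times the value at [y = q ^ n], for
    [n] any integer. *)
Definition residue_sum A B y :=
  euler q B / (euler q q * euler q (B / A)) * pseries (residue_coef A B) y.

Lemma residue_finite_cvg A B y :
  A != 0 -> B != 0 -> nonresonant A B ->
  (fun N => \sum_(j < N) residue_finite A B N j * y ^+ j) @ \oo --> residue_sum A B y.
Proof.
move=> A0 B0 hAB; have hBA := nonresonant_qpoch A0 (nonresonant_sym hAB).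
pose g N j := if (j < N)%N then residue_finite A B N j * y ^+ j else 0.
have -> : (fun N => \sum_(j < N) residue_finite A B N j * y ^+ j) = (fun N => tsum (g N)).
  apply/funext => N; rewrite (@tsum_finite _ _ N) => [|i Ni]; last first.
    by rewrite /g ltnNge Ni.
  by apply: eq_bigr => i _; rewrite /g ltn_ord.
have [M1 M10 h1] := qpoch_bounded q1 B.
have [M2 M20 h2] := qpochV_bounded q1 qq.
have [M3 M30 h3] := qpochV_bounded q1 hBA.
have [L hL] := entire_residue_coef A0 B0 hAB (modulus_ge0 m y).
have M0 : 0 <= M1 * (M2 * M3) by rewrite !mulr_ge0 // ltW.
rewrite /residue_sum -(tsumZ _ (pseries_bounded hL (lexx _))).
apply: (@tannery _ _ m _ _
  (fun j => M1 * (M2 * M3) * (m (residue_coef A B j) * m y ^+ j)) (M1 * (M2 * M3) * L)).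
- move=> N j; rewrite /g; case: ltnP => [jN|_]; last first.
    by rewrite modulus0 !mulr_ge0 ?exprn_ge0 ?modulus_ge0 // ltW.
  rewrite -(subnKC jN) addSnnS residue_finiteE // mulrAC mulrC modulusM.
  rewrite [m (_ * y ^+ j)]modulusM modulusX ler_wpM2r ?mulr_ge0 ?exprn_ge0 ?modulus_ge0 //.
  by rewrite invfM !modulusM !ler_pM ?mulr_ge0 ?modulus_ge0.
- by move=> N; rewrite -mulr_sumr ler_wpM2l.
- move=> j; rewrite -(cvg_shiftn j.+1) /=.
  have -> : (fun n => g (n + j.+1)%N j) = (fun n =>
      qp B n.+1 / (qp q n * qp (B / A) n.+1) * (residue_coef A B j * y ^+ j)).
    apply/funext => n; rewrite /g addnC leq_addr addSnnS.
    by rewrite residue_finiteE // mulrAC mulrC.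
  apply: cvgM; last exact: cvg_cst.
  have cB : (fun n => qp B n.+1) @ \oo --> euler q B.
    by have := @qpoch_cvg _ _ m q q1 B; rewrite -(cvg_shiftS (qp B)).
  have cBA : (fun n => qp (B / A) n.+1) @ \oo --> euler q (B / A).
    by have := @qpoch_cvg _ _ m q q1 (B / A); rewrite -(cvg_shiftS (qp (B / A))).
  apply: cvgM => //; apply: cvgV; last by apply: cvgM => //; exact: (@qpoch_cvg _ _ m q q1 q).
  by rewrite mulf_neq0 ?(euler_neq0 q1).
Qed.

End Residues.

(** * Moments of the residues *)

Section Moments.
Variables (R : realType) (K : numFieldType) (m : real_modulus R K).
Variable q : K.
Hypotheses (q0 : q != 0) (q1 : m q < 1).
Implicit Types (A B x y z : K).

Local Notation nonresonant := (nonresonant q).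

(** The polynomial X^e prod_l (X - A B q^l) of degree [e + N], interpolated at the
    [N + N] nodes; the identity is symmetric in [A] and [B]. *)
Lemma interpolation A B N e : A != 0 -> B != 0 -> nonresonant A B ->
  (e + N < N + N)%N ->
  \sum_(j < N) (A * q ^+ j) ^+ e * \prod_(l < N) (A * q ^+ j - A * B * q ^+ l) /
    ((\prod_(i < N | i != j :> nat) (A * q ^+ j - A * q ^+ i)) *
     \prod_(i < N) (A * q ^+ j - B * q ^+ i)) +
  \sum_(j < N) (B * q ^+ j) ^+ e * \prod_(l < N) (B * q ^+ j - B * A * q ^+ l) /
    ((\prod_(i < N | i != j :> nat) (B * q ^+ j - B * q ^+ i)) *
     \prod_(i < N) (B * q ^+ j - A * q ^+ i)) = ((e + N).+1 == N + N)%:R.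
Proof.
move=> A0 B0 hAB eN.
pose x (i : 'I_N + 'I_N) := match i with inl j => A * q ^+ j | inr j => B * q ^+ j end.
have x_inj : injective x.
  case=> i [] j /= E; first by congr inl; apply/val_inj/(expq_inj q0 q1)/(mulfI A0).
  - by have := hAB i j; rewrite E eqxx.
  - by have := hAB j i; rewrite E eqxx.
  by congr inr; apply/val_inj/(expq_inj q0 q1)/(mulfI B0).
pose P : {poly K} := 'X^e * \prod_(l < N) ('X - (A * B * q ^+ l)%:P).
have mP : P \is monic by rewrite monicMl ?monicXn // monic_prod_XsubC.
have sP : size P = (e + N).+1.
  rewrite size_monicM ?monicXn ?monic_neq0 ?monic_prod_XsubC // size_polyXn.
  rewrite size_prod => [|l _]; last by rewrite polyXsubC_eq0.
  rewrite (eq_bigr (fun=> 2%N)) => [|l _]; last by rewrite size_XsubC.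
  rewrite sum_nat_const card_ord; lia.
have cI : #|{: 'I_N + 'I_N}| = (N + N)%N by rewrite card_sum !card_ord.
have := @lagrange_sum K _ x x_inj P; rewrite sP cI => /(_ eN).
have -> : P`_(N + N).-1 = ((e + N).+1 == N + N)%:R.
  case: eqP => [E|/eqP E].
    by move/monicP: mP; rewrite lead_coefE sP E => ->.
  by rewrite nth_default // sP; move: eN E; lia.
rewrite big_sumType => <-; congr (_ + _); apply: eq_bigr => j _.
  rewrite hornerM horner_prod hornerXn; congr (_ * _ / _).
    by apply: eq_bigr => l _; rewrite hornerXsubC.
  by rewrite big_sumType; congr (_ * _); apply: eq_bigl => i.
rewrite hornerM horner_prod hornerXn; congr (_ * _ / _).
  by apply: eq_bigr => l _; rewrite hornerXsubC /= [B * A]mulrC.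
by rewrite big_sumType mulrC; congr (_ * _); apply: eq_bigl => i.
Qed.

Lemma residue_finite_sum0 A B n : A != 0 -> B != 0 -> nonresonant A B ->
  \sum_(j < n.+1) residue_finite q A B n.+1 j +
  \sum_(j < n.+1) residue_finite q B A n.+1 j = 1.
Proof.
move=> A0 B0 hAB; rewrite (@interpolation A B n.+1 n) //.
by rewrite (_ : (_ == _) = true) //; apply/eqP; lia.
Qed.

Lemma residue_finite_sumN A B n : A != 0 -> B != 0 -> nonresonant A B ->
  A^-1 * (\sum_(j < n.+2) residue_finite q A B n.+2 j * q^-1 ^+ j) +
  B^-1 * (\sum_(j < n.+2) residue_finite q B A n.+2 j * q^-1 ^+ j) = 0.
Proof.
move=> A0 B0 hAB; have le_n : (n + n.+2 < n.+2 + n.+2)%N by lia.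
have := @interpolation A B n.+2 n A0 B0 hAB le_n.
have -> : ((n + n.+2).+1 == n.+2 + n.+2)%:R = 0 :> K.
  by rewrite (_ : (_ == _) = false) //; apply/eqP; lia.
move=> E; rewrite -[RHS]E.
have cancel C j : C != 0 -> (C * q ^+ j) ^+ n = C^-1 * q^-1 ^+ j * (C * q ^+ j) ^+ n.+1.
  by move=> C0; rewrite exprVn exprS; field; rewrite C0 expf_neq0.
by congr (_ + _); rewrite mulr_sumr; apply: eq_bigr => j _; rewrite cancel // /residue_finite; ring.
Qed.

Lemma residue_sum1 A B : A != 0 -> B != 0 -> nonresonant A B ->
  residue_sum q A B 1 + residue_sum q B A 1 = 1.
Proof.
move=> A0 B0 hAB; have hBA := nonresonant_sym hAB.
have lim_sum := cvgD (@residue_finite_cvg _ _ m q q0 q1 A B 1 A0 B0 hAB) (@residue_finite_cvg _ _ m q q0 q1 B A 1 B0 A0 hBA).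
rewrite -(cvg_lim _ (lim_sum _)) //; apply: cvg_lim => //.
apply: (cvg_eventually (v := fun=> 1) (N := 1%N)); last exact: cvg_cst.
case=> // n _; rewrite /= -[RHS](residue_finite_sum0 n A0 B0 hAB).
by congr (_ + _); apply: eq_bigr => j _; rewrite expr1n mulr1.
Qed.

Lemma residue_sumV A B : A != 0 -> B != 0 -> nonresonant A B ->
  A^-1 * residue_sum q A B q^-1 + B^-1 * residue_sum q B A q^-1 = 0.
Proof.
move=> A0 B0 hAB; have hBA := nonresonant_sym hAB.
have lim_sum := cvgD (cvgM (cvg_cst A^-1) (@residue_finite_cvg _ _ m q q0 q1 A B q^-1 A0 B0 hAB))
  (cvgM (cvg_cst B^-1) (@residue_finite_cvg _ _ m q q0 q1 B A q^-1 B0 A0 hBA)).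
rewrite -(cvg_lim _ (lim_sum _ _ _ _ _)) //; apply: cvg_lim => //.
apply: (cvg_eventually (v := fun=> 0) (N := 2%N)); last exact: cvg_cst.
by case=> [|[|n]] // _; rewrite /= -[RHS](residue_finite_sumN n A0 B0 hAB).
Qed.

(** With U_n the n-th moment and [y = q ^ n] this is
    (1 - q^(n+2)) U_(n+2) = (A + B - A B q^(n+1)) U_(n+1) - A B U_n. It is
    symmetric in [A] and [B], so it passes to the sum of the two families of
    moments. *)
Lemma residue_sum_qdiff A B y : A != 0 -> B != 0 -> nonresonant A B ->
  A * B * residue_sum q A B y - (A + B) * A * residue_sum q A B (q * y) +
    A ^+ 2 * residue_sum q A B (q ^+ 2 * y) =
  - (A * B * q * y * A * residue_sum q A B (q * y)) +
    q ^+ 2 * y * A ^+ 2 * residue_sum q A B (q ^+ 2 * y).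
Proof.
move=> A0 B0 hAB; rewrite /residue_sum; set c := euler q B / _.
have h := entire_residue_coef q1 A0 B0 hAB (modulus_ge0 m y).
have m1 : m q <= 1 by exact: ltW.
have m2 : m (q ^+ 2) <= 1 by rewrite modulusX exprn_ile1 ?modulus_ge0.
have h0 := sums_to_pseries h; have hq := sums_to_scale m1 h; have hqq := sums_to_scale m2 h.
set F := pseries _ y in h0 *; set G := pseries _ (q * y) in hq *.
set H := pseries _ (q ^+ 2 * y) in hqq *.
have : F + (- (1 + A / B) * G + A / B * H) = - A * q * (y * G) + A * q ^+ 2 / B * (y * H).
  have [_ <-] := sums_toD h0 (sums_toD (sums_toZ (- (1 + A / B)) hq) (sums_toZ (A / B) hqq)).
  have [_ <-] := sums_toD (sums_toZ (- A * q) (sums_to_shift hq))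
    (sums_toZ (A * q ^+ 2 / B) (sums_to_shift hqq)).
  congr pseries; apply/funext => -[|j] /=; first by rewrite !expr0; ring.
  have sqrX n : (q ^+ 2) ^+ n = q ^+ n * q ^+ n by rewrite exprAC expr2.
  have := residue_coefS q1 j A0 B0 hAB.
  move: (residue_coef q A B j.+1) (residue_coef q A B j) => u v E.
  rewrite -[LHS](_ : (1 - q ^+ j.+1) * (1 - A / B * q ^+ j.+1) * u = _); last first.
    by rewrite sqrX; ring.
  by rewrite E sqrX exprS; ring.
move/(congr1 (fun t => A * B * c * t)) => E.
apply/eqP; rewrite -subr_eq0; apply/eqP; move/eqP: E; rewrite -subr_eq0 => /eqP <-.
by field.
Qed.

(** The recurrence run backwards from U_0 = 1 and U_(-1) = 0: at U_(-2) the factor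
    1 - q^0 removes U_0, and nothing but zeros enters afterwards. *)
Lemma residue_sum_negative A B n : A != 0 -> B != 0 -> nonresonant A B ->
  A^-1 ^+ n.+1 * residue_sum q A B (q^-1 ^+ n.+1) +
  B^-1 ^+ n.+1 * residue_sum q B A (q^-1 ^+ n.+1) = 0.
Proof.
move=> A0 B0 hAB; have hBA := nonresonant_sym hAB.
pose U n := A^-1 ^+ n * residue_sum q A B (q^-1 ^+ n) + B^-1 ^+ n * residue_sum q B A (q^-1 ^+ n).
have U0 : U 0%N = 1 by rewrite /U !expr0 !mul1r residue_sum1.
have U1 : U 1%N = 0 by rewrite /U !expr1 residue_sumV.
have step k : A * B * U k.+2 = (A + B - A * B * q^-1 ^+ k.+1) * U k.+1 -
    (1 - q^-1 ^+ k) * U k.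
  have := residue_sum_qdiff (q^-1 ^+ k.+2) A0 B0 hAB.
  have := residue_sum_qdiff (q^-1 ^+ k.+2) B0 A0 hBA.
  have E1 : q * q^-1 ^+ k.+2 = q^-1 ^+ k.+1 by rewrite exprS mulVKf.
  have E2 : q ^+ 2 * q^-1 ^+ k.+2 = q^-1 ^+ k by rewrite expr2 -mulrA E1 exprS mulVKf.
  rewrite E1 E2 => HB HA.
  have {}HA := congr1 (fun t => A^-1 ^+ k.+2 * t) HA.
  have {}HB := congr1 (fun t => B^-1 ^+ k.+2 * t) HB.
  have := congr2 (fun s t => s + t) HA HB.
  rewrite -![_ * q * q^-1 ^+ k.+2]mulrA E1.
  move=> E; apply/eqP; rewrite -subr_eq0; apply/eqP; move/eqP: E; rewrite -subr_eq0 => /eqP <-.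
  by rewrite /U !exprS; field; rewrite q0 A0 B0.
rewrite -/(U n.+1); suff: U n.+1 = 0 /\ U n.+2 = 0 by case.
have AB0 : A * B != 0 by rewrite mulf_neq0.
elim: n => [|n [IH1 IH2]]; split=> //; apply: (mulfI AB0); rewrite step mulr0.
  by rewrite U1 U0 !expr0; ring.
by rewrite IH1 IH2; ring.
Qed.

(** Both sides satisfy one second-order recurrence; the moment U_1 is
    obtained from U_0 = 1 and U_(-1) = 0. *)
Lemma phi_num_residue A B n : A != 0 -> B != 0 -> nonresonant A B ->
  phi_num q A B 0 n = (-1) ^+ n * tri q n *
    (A ^+ n * residue_sum q A B (q ^+ n) + B ^+ n * residue_sum q B A (q ^+ n)).
Proof.
move=> A0 B0 hAB; have hBA := nonresonant_sym hAB.
pose U n := A ^+ n * residue_sum q A B (q ^+ n) + B ^+ n * residue_sum q B A (q ^+ n).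
have U0 : U 0%N = 1 by rewrite /U !expr0 !mul1r residue_sum1.
have UN : A^-1 * residue_sum q A B q^-1 + B^-1 * residue_sum q B A q^-1 = 0.
  exact: residue_sumV.
have hC k : (0 : K) * q * q ^+ k != 1 by rewrite !mul0r eq_sym oner_eq0.
have U1 : (1 - q) * U 1%N = A + B - A * B.
  have HA := residue_sum_qdiff q^-1 A0 B0 hAB; have HB := residue_sum_qdiff q^-1 B0 A0 hBA.
  have E2 : q ^+ 2 * q^-1 = q by rewrite expr2 mulfK.
  rewrite mulfV // E2 in HA HB.
  have {}HA := congr1 (fun t => A^-1 * t) HA.
  have {}HB := congr1 (fun t => B^-1 * t) HB.
  have E := congr2 (fun s t => s + t) HA HB.
  have <- : (A + B - A * B) * U 0%N - A * B *
    (A^-1 * residue_sum q A B q^-1 + B^-1 * residue_sum q B A q^-1) = A + B - A * B.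
    by rewrite UN U0; ring.
  apply/eqP; rewrite -subr_eq0; apply/eqP; move/eqP: E; rewrite -subr_eq0 => /eqP <-.
  by rewrite /U !expr0 !expr1; field; rewrite q0 A0 B0.
have step k : (1 - q ^+ k.+2) * U k.+2 = (A + B - A * B * q ^+ k.+1) * U k.+1 - A * B * U k.
  have HA := residue_sum_qdiff (q ^+ k) A0 B0 hAB.
  have HB := residue_sum_qdiff (q ^+ k) B0 A0 hBA.
  rewrite -![_ * q * q ^+ k]mulrA -!exprS in HA HB.
  have {}HA := congr1 (fun t => A ^+ k * t) HA.
  have {}HB := congr1 (fun t => B ^+ k * t) HB.
  have E := congr2 (fun s t => s + t) HA HB.
  apply/eqP; rewrite -subr_eq0; apply/eqP; move/eqP: E; rewrite -subr_eq0 => /eqP <-.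
  by rewrite /U !exprS; ring.
rewrite -/(U n).
have P1 : phi_num q A B 0 1 = (-1) ^+ 1 * tri q 1 * U 1%N.
  apply: (mulfI (one_subX_neq0 q1 0)); rewrite expr1.
  have := phi_num1 q1 A B hC; rewrite !mul0r addr0 subr0 mulr1 => ->.
  rewrite triS tri0 !expr1 expr0 [RHS]mulrCA U1; ring.
suff: phi_num q A B 0 n = (-1) ^+ n * tri q n * U n /\
  phi_num q A B 0 n.+1 = (-1) ^+ n.+1 * tri q n.+1 * U n.+1 by case.
elim: n => [|n [IH1 IH2]]; first by split=> //; rewrite phi_num0 U0 tri0 !mulr1.
split=> //; apply: (mulfI (one_subX_neq0 q1 n.+1)).
have := phi_numSS q1 A B hC n; rewrite !mul0r addr0 subr0 mulr1 IH1 IH2 => ->.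
rewrite [RHS]mulrCA step !triS !exprS; ring.
Qed.

End Moments.

(** * The connection formula near infinity *)

Section Connection.
Variables (R : realType) (K : numFieldType) (m : real_modulus R K).
Variable q : K.
Hypotheses (q0 : q != 0) (q1 : m q < 1).
Implicit Types (A B x y z : K).

Local Notation nonresonant := (nonresonant q).

Definition connection_coef A B := euler q B / (euler q q * euler q (B / A)).

(** One of the two terms of the formula, multiplied by theta(-qx), with
    [A = q / a], [B = q / b] and [z = a * b * x]. *)
Definition connection_term A B z :=
  connection_coef A B * theta q (- (z * A)) * phi_fun q (q / B) 0 (A / B) (q / z).

Let hC A B : B != 0 -> nonresonant A B -> forall k, A / B * q * q ^+ k != 1.
Proof. by move=> *; apply: nonresonant_qpochS. Qed.

Lemma qpoch_zero n : qpoch q 0 n = 1.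
Proof. by rewrite /qpoch big1 // => i _; rewrite mul0r subr0. Qed.

Lemma residueE A B z j : A != 0 -> z != 0 -> residue q A B j =
  connection_coef A B * (phi_coef q (q / B) 0 (A / B) j * (q / z) ^+ j) *
  (tri q j * (- (z * A)) ^+ j).
Proof.
move=> A0 z0; rewrite /residue -/(connection_coef A B) /residue_coef triS /phi_coef qpoch_zero.
rewrite -mulrN !exprMn exprVn mulr1 [qpoch q q j * _]mulrC.
by set X := _ / (_ * _); set Y := connection_coef A B; field; rewrite expf_neq0.
Qed.

(** The double series sum_j R_j theta(-z A q^j), summed in two ways: over [j]
    first, it gives the moments, nonnegative ones in [u] and negative ones in [v];
    over the powers of [z] first, quasi-periodicity turns it into a series 2phi1.
    The moduli of the terms add up to a multiple of the modulus of the j-th term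
    of this last series, which justifies the exchange. *)
Lemma connection_side A B z : A != 0 -> B != 0 -> nonresonant A B -> z != 0 ->
  m (q / z) < 1 -> exists u v : K,
  [/\ series (fun n => (-1) ^+ n * tri q n * (A ^+ n * residue_sum q A B (q ^+ n)) * z ^+ n) @ \oo --> u,
      series (fun n => tri q n.+2 * (- z^-1) ^+ n.+1 *
        (A^-1 ^+ n.+1 * residue_sum q A B (q^-1 ^+ n.+1))) @ \oo --> v
    & u + v = connection_term A B z].
Proof.
move=> A0 B0 hAB z0 qz.
pose x0 := - (z * A); have x00 : x0 != 0 by rewrite oppr_eq0 mulf_neq0.
pose x j := q ^+ j * x0; have xj0 j : x j != 0 by rewrite mulf_neq0 ?expf_neq0.
pose c := connection_coef A B; pose p := phi_coef q (q / B) 0 (A / B).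
have [L hL] := phi_converges q1 (q / B) 0 (hC B0 hAB) (modulus_ge0 m (q / z)) qz.
pose T := theta (m q) (m x0).
pose b j := m c * (m (p j) * m (q / z) ^+ j) * T.
have bL : sum_bounded b (m c * L * T).
  have T0 : 0 <= T by have [h _] := theta_bound q1 x00; have := h 0%N; rewrite big_ord0.
  by move=> N; rewrite /b -mulr_suml ler_wpM2r // -mulr_sumr ler_wpM2l ?modulus_ge0.
have bE j : m (residue q A B j) * theta (m q) (m (x j)) = b j.
  rewrite (residueE B j A0 z0) -/x0 -/c -/p /b /T (theta_bound_shift q0 q1 j x00) -/(x j).
  move: (theta _ _) => th.
  by rewrite modulusM [m (c * _)]modulusM [m (p j * _)]modulusM [m (_ ^+ j)]modulusX; ring.
have [P1 P2] : (forall j, sum_bounded (m \o (fun n => residue q A B j * (tri q n * x j ^+ n))) (b j)) /\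
    (forall j, sum_bounded (m \o (fun n => residue q A B j * (tri q n.+2 * (x j)^-1 ^+ n.+1))) (b j)).
  split=> j N; rewrite -bE; have [h1 h2] := theta_bound q1 (xj0 j).
    apply: le_trans (ler_wpM2l (modulus_ge0 m _) (h1 N)); rewrite mulr_sumr.
    by apply: ler_sum => i _ /=; rewrite [m (residue _ _ _ _ * _)]modulusM.
  apply: le_trans (ler_wpM2l (modulus_ge0 m _) (h2 N)); rewrite mulr_sumr.
  by apply: ler_sum => i _ /=; rewrite [m (residue _ _ _ _ * _)]modulusM.
have E1 := tsum_exchange P1 bL; have E2 := tsum_exchange P2 bL.
have thx j : theta q (x j) = tsum (fun n => tri q n * x j ^+ n) +
    tsum (fun n => tri q n.+2 * (x j)^-1 ^+ n.+1).
  by congr (_ + tsum _); apply/funext => n; rewrite exprVn.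
have [B1 B2] : (forall j, sum_bounded (m \o (fun n => tri q n * x j ^+ n)) (theta (m q) (m (x j)))) /\
    (forall j, sum_bounded (m \o (fun n => tri q n.+2 * (x j)^-1 ^+ n.+1)) (theta (m q) (m (x j)))).
  by split=> j; have [] := theta_bound q1 (xj0 j).
have tb (f : nat -> nat -> K) : (forall j, sum_bounded (m \o f j) (b j)) ->
    sum_bounded (m \o (fun j => tsum (f j))) (m c * L * T).
  by move=> hf; apply: sum_bounded_le bL => j; apply: modulus_tsum (hf j).
exists (tsum (fun j => tsum (fun n => residue q A B j * (tri q n * x j ^+ n)))).
exists (tsum (fun j => tsum (fun n => residue q A B j * (tri q n.+2 * (x j)^-1 ^+ n.+1)))).
split; last 1 first.
- rewrite -(tsumD (tb _ P1) (tb _ P2)) /=.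
  have -> : (fun j => tsum (fun n => residue q A B j * (tri q n * x j ^+ n)) +
      tsum (fun n => residue q A B j * (tri q n.+2 * (x j)^-1 ^+ n.+1))) =
    (fun j => c * theta q x0 * (p j * (q / z) ^+ j)).
    apply/funext => j; rewrite (tsumZ _ (B1 j)) (tsumZ _ (B2 j)) -mulrDr -thx.
    by rewrite (residueE B j A0 z0) (theta_shiftn q0 q1 j x00) /c /p /x -/x0; ring.
  rewrite (tsumZ _ (pseries_bounded hL (lexx _))) /connection_term; congr (_ * _).
  rewrite /phi_fun (phi_numE q1) //; last exact: hC.
  rewrite mulrAC mulfV ?mul1r //; apply: (euler_neq0 q1) => k; apply/eqP => /(congr1 m).
  rewrite modulusM modulusX modulus1.
  have : m q ^+ k <= 1 by rewrite exprn_ile1 ?modulus_ge0 // ltW.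
  have := modulus_ge0 m (q / z); have : 0 <= m q ^+ k by rewrite exprn_ge0 ?modulus_ge0.
  nra.
- suff -> : (fun n => (-1) ^+ n * tri q n * (A ^+ n * residue_sum q A B (q ^+ n)) * z ^+ n) =
      (fun n => tsum (fun j => residue q A B j * (tri q n * x j ^+ n))) by exact: E1.
  apply/funext => n.
  have [M hM] := entire_residue_coef q1 A0 B0 hAB (modulus_ge0 m (q ^+ n)).
  have -> : (fun j => residue q A B j * (tri q n * x j ^+ n)) =
     (fun j => c * tri q n * (- (z * A)) ^+ n * (residue_coef q A B j * (q ^+ n) ^+ j)).
    apply/funext => j; rewrite /residue -/(connection_coef A B) -/c /x -/x0.
    by rewrite exprMn -!exprM mulnC; ring.
  rewrite (tsumZ _ (pseries_bounded hM (lexx _))) /residue_sum -/(connection_coef A B) -/c.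
  by rewrite -[- (z * A)]mulN1r !exprMn /pseries; ring.
- suff -> : (fun n => tri q n.+2 * (- z^-1) ^+ n.+1 *
      (A^-1 ^+ n.+1 * residue_sum q A B (q^-1 ^+ n.+1))) =
      (fun n => tsum (fun j => residue q A B j * (tri q n.+2 * (x j)^-1 ^+ n.+1))) by exact: E2.
  apply/funext => n.
  have [M hM] := entire_residue_coef q1 A0 B0 hAB (modulus_ge0 m (q^-1 ^+ n.+1)).
  have -> : (fun j => residue q A B j * (tri q n.+2 * (x j)^-1 ^+ n.+1)) =
     (fun j => c * tri q n.+2 * (- (z * A))^-1 ^+ n.+1 *
       (residue_coef q A B j * (q^-1 ^+ n.+1) ^+ j)).
    apply/funext => j; rewrite /residue -/(connection_coef A B) -/c /x -/x0.
    by rewrite invfM exprMn -exprVn -!exprM mulnC; ring.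
  rewrite (tsumZ _ (pseries_bounded hM (lexx _))) /residue_sum -/(connection_coef A B) -/c.
  by rewrite invrN invfM -mulNr exprMn /pseries; ring.
Qed.

(** Taylor coefficients of the left-hand side are the nonnegative moments; the
    bilateral series needed for theta comes from the vanishing of the others. *)
Lemma connection_disc A B z : A != 0 -> B != 0 -> nonresonant A B -> z != 0 ->
  m (q / z) < 1 ->
  pseries (phi_num q A B 0) z = connection_term A B z + connection_term B A z.
Proof.
move=> A0 B0 hAB z0 qz.
have [u [v [hu hv <-]]] := connection_side A0 B0 hAB z0 qz.
have [u' [v' [hu' hv' <-]]] := connection_side B0 A0 (nonresonant_sym hAB) z0 qz.
have seriesD (f g : nat -> K) : series (fun n => f n + g n) = (fun n => series f n + series g n).
  by apply/funext => n; rewrite !seriesE big_split.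
have vv : v + v' = 0.
  have := cvgD hv hv'; set w := (X in X @ _ --> _) => h.
  rewrite -(cvg_lim _ (h _)) //; apply: cvg_lim => //.
  have -> : w = (fun=> 0); last exact: cvg_cst.
  apply/funext => n; rewrite /w /= fctE !seriesE -big_split big1 // => i _.
  by rewrite /= -mulrDr (residue_sum_negative q0 q1) ?mulr0.
have -> : u + v + (u' + v') = u + u' by rewrite addrACA vv addr0.
apply: tsum_eq; have h := cvgD hu hu'.
have -> : series (fun n => phi_num q A B 0 n * z ^+ n) = (fun n =>
    series (fun n => (-1) ^+ n * tri q n * (A ^+ n * residue_sum q A B (q ^+ n)) * z ^+ n) n +
    series (fun n => (-1) ^+ n * tri q n * (B ^+ n * residue_sum q B A (q ^+ n)) * z ^+ n) n).
  rewrite -seriesD; congr series; apply/funext => n.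
  by rewrite (phi_num_residue q0 q1) //; ring.
exact: h.
Qed.

End Connection.

(** * The connection formula in the plane *)

Section Plane.
Variables (R : realType) (K : numFieldType) (m : real_modulus R K).
Variable q : K.
Hypotheses (q0 : q != 0) (q1 : m q < 1).
Implicit Types (A B x y z : K).

Local Notation nonresonant := (nonresonant q).

Lemma phi_num_unit A n : phi_num q A 1 0 n = euler_coef q n.
Proof.
rewrite /phi_num /conv big_ord_recr /= subnn big1 => [|i _].
  by rewrite add0r /phi_coef !qpoch0 !mul1r invr1 mulr1.
rewrite /phi_coef; have : (0 < n - i)%N by rewrite subn_gt0.
case: (n - i)%N => // k _.
by rewrite [qpoch q 1 _]big_ord_recl expr0 mulr1 subrr mul0r mulr0 mul0r mulr0.
Qed.

(** For [B = 1] the left-hand side of [connection_disc] is (z;q)_oo, and one term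
    on the right vanishes with (1;q)_oo: what remains has theta(-z) as a factor. *)
Lemma theta_neq0_annulus A z : A != 0 -> nonresonant A 1 -> z != 0 -> m (q / z) < 1 ->
  (forall k, z * q ^+ k != 1) -> theta q (- z) != 0.
Proof.
move=> A0 hA z0 qz hz; apply/eqP => t0.
have := connection_disc q0 q1 A0 (oner_neq0 K) hA z0 qz.
rewrite (_ : pseries _ z = euler q z); last by congr pseries; apply/funext/phi_num_unit.
rewrite /connection_term /connection_coef mulr1 t0.
rewrite (eulerS q1 1) subrr !(mul0r, mulr0, addr0) => /eqP; apply/negP.
exact: (euler_neq0 q1).
Qed.

(** Quasi-periodicity reduces to [m (q / z) < 1]. *)
Lemma theta_neq0 A z : A != 0 -> nonresonant A 1 -> z != 0 ->
  (forall k n, z * q ^+ k != q ^+ n) -> theta q (- z) != 0.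
Proof.
move=> A0 hA z0 hz.
have mz : 0 < m z by rewrite modulus_gt0.
have [n /(_ n.+1 (leqnSn n))] := exp_small q1 mz.
rewrite -modulusX => hn; have qn : q ^+ n != 0 by rewrite expf_neq0.
pose y := z / q ^+ n; have y0 : y != 0 by rewrite mulf_neq0 ?invr_eq0.
have : theta q (- y) != 0.
  apply: (@theta_neq0_annulus A) => // [|k].
    rewrite /y invf_div mulrA -exprS modulusM modulusV ltr_pdivrMr ?mul1r //.
  apply: contra (hz k n) => /eqP E; apply/eqP.
  by rewrite -[RHS]mul1r -E /y; field.
have -> : - z = q ^+ n * - y by rewrite /y; field.
rewrite (theta_shiftn q0 q1 n) ?oppr_eq0 // => h; apply: contra h => /eqP ->.
by rewrite mulr0.
Qed.

(** The factors from the quasi-periodicity of theta turn the q-difference equation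
    of 2phi1 in q/z into the one that [phi_num_qdiff] states for the left-hand
    side, in [z]. *)
Lemma connection_term_qdiff A B z : A != 0 -> B != 0 -> nonresonant A B -> z != 0 ->
  ~ phi21_poles q (q / (q ^+ 2 * z)) ->
  A * B * z * (1 - q * z) * connection_term q A B (q ^+ 2 * z) =
  connection_term q A B z - (1 - (A + B) * z) * connection_term q A B (q * z).
Proof.
move=> A0 B0 hAB z0 np; rewrite /connection_term; set c := connection_coef _ _ _.
have hC : forall k, A / B * q * q ^+ k != 1 by apply: nonresonant_qpochS.
have := phi_fun_qdiff q0 q1 (q / B) 0 hC np.
have -> : q * (q / (q ^+ 2 * z)) = q / (q * z) by field; rewrite q0 z0.
have -> : q ^+ 2 * (q / (q ^+ 2 * z)) = q / z by field; rewrite q0 z0.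
have t1 := theta_shift q0 q1 (x := - (z * A)); have t2 := theta_shift q0 q1 (x := - (q * z * A)).
rewrite t1 ?oppr_eq0 ?mulf_neq0 // (_ : q * - (z * A) = - (q * z * A)); last by ring.
rewrite t2 ?oppr_eq0 ?mulf_neq0 // (_ : q * - (q * z * A) = - (q ^+ 2 * z * A)); last by ring.
move: (theta q _) (phi_fun _ _ _ _ _) (phi_fun _ _ _ _ (q / (q * z))) (phi_fun _ _ _ _ _).
move=> t F G H E.
have {}E := congr1 (fun x => - c * t * A * B * q * z * z * x) E.
apply/eqP; rewrite -subr_eq0; apply/eqP; move/eqP: E; rewrite -subr_eq0 => /eqP <-.
by field; rewrite q0 z0 B0.
Qed.

(** The equation just proved expresses the value at [q ^+ 2 * y] by those at [y]
    and [q * y], provided that [1 - q * y] is nonzero, which is guaranteed by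
    [q / z] not being 1. *)
Lemma connection A B z : A != 0 -> B != 0 -> nonresonant A B -> z != 0 ->
  ~ phi21_poles q (q / z) ->
  pseries (phi_num q A B 0) z = connection_term q A B z + connection_term q B A z.
Proof.
move=> A0 B0 hAB z0 np.
have mz : 0 < m z by rewrite modulus_gt0.
have [n /(_ n.+1 (leqnSn n))] := exp_small q1 mz.
rewrite -modulusX -[ltRHS]mul1r -ltr_pdivrMr // -modulusV -modulusM.
elim/ltn_ind: n z z0 np {mz} => -[|n] IH z z0 np hn; first exact: (connection_disc q0 q1 A0 B0 hAB z0 hn).
have hC k : (0 : K) * q * q ^+ k != 1 by rewrite !mul0r eq_sym oner_eq0.
pose y := z / q ^+ 2; have y0 : y != 0 by rewrite mulf_neq0 ?invr_eq0 ?expf_neq0.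
have zE : z = q ^+ 2 * y by rewrite /y; field.
clearbody y.
have np1 : ~ phi21_poles q (q / (q * y)).
  move=> [k E]; apply: np; exists k.+1.
  have -> : q / z = q^-1 * (q / (q * y)) by rewrite zE; field; rewrite q0 y0.
  by rewrite E exprS invfM.
have np2 : ~ phi21_poles q (q / y).
  move=> [k E]; apply: np; exists k.+2.
  have -> : q / z = q^-1 * (q^-1 * (q / y)) by rewrite zE; field; rewrite q0 y0.
  by rewrite E !exprS !invfM.
have m1 (x : K) : m x < 1 -> m (q * x) < 1.
  by move=> x1; apply: le_lt_trans x1; rewrite modulusM ler_piMl ?modulus_ge0 // ltW.
have h1 : m (q ^+ n.+1 / (q * y)) < 1.
  by move: hn; rewrite zE; congr (m _ < 1); rewrite !exprS; field; rewrite q0 y0.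
have h2 : m (q ^+ n.+1 / y) < 1.
  by have := m1 _ h1; congr (m _ < 1); field; rewrite q0 y0.
have := phi_num_qdiff q1 A B hC y; rewrite -zE.
rewrite (IH n (leqnn _) _ y0 np2 h2).
have qy0 : q * y != 0 by apply: mulf_neq0.
rewrite (IH n (leqnn _) _ qy0 np1 h1) => E.
have hBA := nonresonant_sym hAB.
have npz : ~ phi21_poles q (q / (q ^+ 2 * y)) by rewrite -zE.
have EA := connection_term_qdiff A0 B0 hAB y0 npz.
have EB := connection_term_qdiff B0 A0 hBA y0 npz.
rewrite -zE in EA EB.
have qy : 1 - q * y != 0.
  rewrite subr_eq0; apply/eqP => qy1; apply: np; exists 0%N.
  by rewrite zE expr2 -[q * q * y]mulrA -qy1 mulr1 mulfV // expr0 invr1.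
have c0 : A * B * y * (1 - q * y) != 0 by rewrite !mulf_neq0.
apply: (mulfI c0); rewrite [RHS]mulrDr EA -[A * B](mulrC B A) EB.
move: E; rewrite addr0 subr0 => E.
apply/eqP; rewrite -subr_eq0; apply/eqP; move/esym/eqP: E; rewrite -subr_eq0 => /eqP E.
by rewrite -[RHS]E; ring.
Qed.

Lemma nonresonant_of_ratio A B : B != 0 -> (forall k : int, A / B != q ^ k) ->
  nonresonant A B.
Proof.
move=> B0 h k n; apply/eqP => E; have /eqP := h (n%:Z - k%:Z); apply.
rewrite expfzDr // -exprnP -invr_expz -exprnP.
by apply: (mulIf (expf_neq0 k q0)); rewrite divfK ?expf_neq0 // mulrAC E mulrAC mulfV ?mul1r.
Qed.

Theorem connection_formula a b (a0 : a != 0) (b0 : b != 0)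
    (hab : forall k : int, a / b != q ^ k) :
  let lhs x :=
    qpoch_inf q (a * b * x) / theta q (- (q * x)) *
      phi21 q (q / a) (q / b) 0 (a * b * x) in
  let rhs x :=
    qpoch_inf q (q / a) / (qpoch_inf q (b / a) * qpoch_inf q q) *
      (theta q (- (a * q * x)) / theta q (- (q * x))) *
      phi21 q a 0 (a * q / b) (q / (a * b * x)) +
    qpoch_inf q (q / b) / (qpoch_inf q (a / b) * qpoch_inf q q) *
      (theta q (- (b * q * x)) / theta q (- (q * x))) *
      phi21 q b 0 (b * q / a) (q / (a * b * x)) in
  exists H : K -> K, forall x, x != 0 -> ~ qspiral q 1 x ->
    [/\ holomorphic_at H x,
        ~ phi21_poles q (a * b * x) -> lhs x = H x
      & ~ phi21_poles q (q / (a * b * x)) -> rhs x = H x].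
Proof.
pose A := q / a; pose B := q / b.
have A0 : A != 0 by rewrite mulf_neq0 ?invr_eq0.
have B0 : B != 0 by rewrite mulf_neq0 ?invr_eq0.
have hBA : nonresonant B A.
  apply: nonresonant_of_ratio => // k; have := hab k; congr (_ != _).
  by rewrite /A /B; field; rewrite q0 a0 b0.
have hAB := nonresonant_sym hBA.
have u0 : a / b != 0 by rewrite mulf_neq0 ?invr_eq0.
have hu : nonresonant (a / b) 1.
  by apply: nonresonant_of_ratio; rewrite ?oner_neq0 // => k; rewrite divr1.
move=> lhs rhs; exists (fun x => pseries (phi_num q A B 0) (a * b * x) / theta q (- (q * x))).
move=> x x0 xq.
have ab0 : a * b != 0 by rewrite mulf_neq0.
have hC k : (0 : K) * q * q ^+ k != 1 by rewrite !mul0r eq_sym oner_eq0.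
have th0 : theta q (- (q * x)) != 0.
  apply: (theta_neq0 u0 hu); first by rewrite mulf_neq0.
  move=> k n; apply/eqP => E; apply: xq; exists (n%:Z - k.+1%:Z).
  rewrite mul1r expfzDr // -exprnP -invr_expz -exprnP -E exprS.
  by field; rewrite q0 expf_neq0.
have cont (C D c : K) : (forall k, c * q * q ^+ k != 1) -> forall y, ~ phi21_poles q y ->
    phi21 q C D (c * q) y = phi_fun q C D c y.
  move=> h y; apply: (phi21_eq m); exact: (phi_fun_continuation q0 q1 _ _ h).
split.
- apply: (holomorphicM m).
    apply: (holomorphic_comp m (g := pseries (phi_num q A B 0))).
      exact: holomorphic_entire (entire_phi_num q1 A B hC).
    by apply: holomorphic_eq (holomorphic_affine m (a * b) 0 x) => w; rewrite addr0.
  apply: (holomorphicV m) => //; apply: (holomorphic_comp m (g := theta q)).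
    by apply: (holomorphic_theta q1); rewrite oppr_eq0 mulf_neq0.
  by apply: holomorphic_eq (holomorphic_affine m (- q) 0 x) => w; rewrite addr0 mulNr.
- move=> np; rewrite /lhs (qpoch_infE q1) -(mul0r q) cont // /phi_fun.
  have e0 : euler q (a * b * x) != 0 by apply: (euler_neq0 q1); apply/(phi21_polesP q0).
  by rewrite mul0r; field; rewrite th0 e0.
move=> np; have z0 : a * b * x != 0 by rewrite mulf_neq0.
rewrite (connection A0 B0 hAB z0 np) /rhs !(qpoch_infE q1).
have hCA : forall k, A / B * q * q ^+ k != 1 by apply: nonresonant_qpochS.
have hCB : forall k, B / A * q * q ^+ k != 1 by apply: nonresonant_qpochS.
have BA : B / A = a / b by rewrite /A /B; field; rewrite q0 a0 b0.
have AB : A / B = b / a by rewrite /A /B; field; rewrite q0 a0 b0.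
rewrite /connection_term /connection_coef -(cont _ _ _ hCA _ np) -(cont _ _ _ hCB _ np).
rewrite AB BA.
have -> : a * b * x * A = b * q * x by rewrite /A; field.
have -> : a * b * x * B = a * q * x by rewrite /B; field.
have -> : q / A = a by rewrite /A; field; rewrite q0 a0.
have -> : q / B = b by rewrite /B; field; rewrite q0 b0.
have -> : b * q / a = b / a * q by rewrite mulrAC.
have -> : a * q / b = a / b * q by rewrite mulrAC.
rewrite -/A -/B [euler q (a / b) * _]mulrC [euler q (b / a) * _]mulrC.
by ring.
Qed.

End Plane.

(** * The complex numbers *)

Section Complex.
Variable R : realType.
Local Open Scope complex_scope.

Let C : numFieldType := R[i].

Local Notation normc := ComplexField.Normc.normc.

Lemma cvg_real_complex (u : nat -> R) (l : R) : u @ \oo --> l ->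
  (fun n => ((u n)%:C : C)) @ \oo --> (l%:C : C).
Proof.
move=> /cvgrPdist_lt ul; apply/cvgrPdist_lt => e e0.
have [Ee re0] : e = (complex.Re e)%:C /\ 0 < complex.Re e.
  by case: e e0 => x y; rewrite ltcE /= => /andP[/eqP -> ?].
apply: filterS (ul _ re0) => n; rewrite Ee -rmorphB /= normc_def /= expr0n addr0 sqrtr_sqr.
by rewrite ltcR.
Qed.

Lemma complex_absolutely_summable_cvg (u : nat -> C) (B : R) :
  (forall N, \sum_(i < N) normc (u i) <= B) -> cvgn (series u).
Proof.
move=> h.
have part (f : R[i] -> R) : (forall z, `|f z| <= normc z) -> cvgn (series (f \o u)).
  move=> fz; apply: (@real_absolutely_summable_cvg _ _ B) => N.
  by apply: le_trans (h N); apply: ler_sum => i _; apply: fz.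
have reS : cvgn (series (@complex.Re R \o u)).
  apply: part; case=> x y /=.
  by rewrite -sqrtr_sqr ler_sqrt ?addr_ge0 ?sqr_ge0 // lerDl sqr_ge0.
have imS : cvgn (series (@complex.Im R \o u)).
  apply: part; case=> x y /=.
  by rewrite -sqrtr_sqr ler_sqrt ?addr_ge0 ?sqr_ge0 // lerDr sqr_ge0.
suff -> : series u = (fun n => ((series (@complex.Re R \o u) n)%:C : C) +
    'i%C * ((series (@complex.Im R \o u) n)%:C : C)).
  apply/cvg_ex; eexists; apply: cvgD; first exact: cvg_real_complex reS.
  by apply: cvgM; [exact: cvg_cst|exact: cvg_real_complex imS].
apply/funext => n; rewrite !seriesE !rmorph_sum mulr_sumr -big_split.
by apply: eq_bigr => i _; apply: complexE.
Qed.

Definition complex_modulus : real_modulus R C :=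
  @RealModulus R C (fun z => normc z) (real_complex R) (@lecR R) (fun=> erefl)
    complex_absolutely_summable_cvg.

End Complex.

Theorem theorem1 (R : realType) (q a b : R[i])
    (q_neq0 : q != 0) (q_lt1 : `|q| < 1)
    (a_neq0 : a != 0) (b_neq0 : b != 0)
    (ab_nonres : forall k : int, a / b != q ^ k) :
  let lhs (x : R[i]) : R[i] :=
    qpoch_inf q (a * b * x) / theta q (- (q * x)) *
      phi21 q (q / a) (q / b) 0 (a * b * x) in
  let rhs (x : R[i]) : R[i] :=
    qpoch_inf q (q / a) / (qpoch_inf q (b / a) * qpoch_inf q q) *
      (theta q (- (a * q * x)) / theta q (- (q * x))) *
      phi21 q a 0 (a * q / b) (q / (a * b * x)) +
    qpoch_inf q (q / b) / (qpoch_inf q (a / b) * qpoch_inf q q) *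
      (theta q (- (b * q * x)) / theta q (- (q * x))) *
      phi21 q b 0 (b * q / a) (q / (a * b * x)) in
  exists H : R[i] -> R[i],
    forall x : R[i], x != 0 -> ~ qspiral q 1 x ->
    [/\ holomorphic_at H x,
        ~ phi21_poles q (a * b * x) -> lhs x = H x
      & ~ phi21_poles q (q / (a * b * x)) -> rhs x = H x].
Proof.
have q1 : complex_modulus R q < 1 by move: q_lt1; rewrite -ltcR.
exact: (connection_formula q_neq0 q1 a_neq0 b_neq0 ab_nonres).
Qed.
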